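(* For a Banach space $X$, the following assertions are equivalent: (i) $X$ has the Dunford-Pettis property; (ii) $\operatorname{cc}(T)\le 2\omega(T^* )$ for every operator $T$ from $X$ to any Banach space $Y$; (iii) $\operatorname{cc}(T^* )\le 2\omega(T)$ for every operator $T$ from any Banach space $Y$ to $X$; (iv) $\limsup_n|x_n^*(x_n)|\le\omega(\{x_n^*:n\in\mathbb N\})$ whenever $(x_n)$ is a weakly null sequence in $B_X$ and $(x_n^* )$ is a bounded sequence in $X^*$; (v) $\limsup_n|x_n^*(x_n)|\le\omega(\{x_n:n\in\mathbb N\})$ whenever $(x_n)$ is a bounded sequence in $X$ and $(x_n^* )$ is a weakly null sequence in $B_{X^*}$; (vi) $\widetilde{\operatorname{ca}}_{\rho^*}(x_n^* )\le2\omega(\{x_n^*:n\in\mathbb N\})$ whenever $(x_n^* )$ is a bounded sequence in $X^*$; (vii) $\widetilde{\operatorname{ca}}_{\rho}(x_n)\le2\omega(\{x_n:n\in\mathbb N\})$ whenever $(x_n)$ is a bounded sequence in $X$.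
   Context: Banach spaces are real or complex; $B_X$ is the closed unit ball; operator means bounded linear operator. $X$ has the Dunford-Pettis property if for every Banach space $Y$ every weakly compact operator $T:X\to Y$ is completely continuous (maps weakly convergent sequences to norm convergent ones). For a bounded sequence $(z_k)$ in a Banach space, $\operatorname{ca}(z_k)=\inf_{n}\sup_{k,l\ge n}\|z_k-z_l\|$. For an operator $T:X\to Y$, $\operatorname{cc}(T)=\sup\{\operatorname{ca}(Tx_k):(x_k)\text{ is a weakly Cauchy sequence in }B_X\}$. For nonempty $A,B$, $\widehat{\operatorname{d}}(A,B)=\sup_{a\in A}\inf_{b\in B}\|a-b\|$. For a bounded subset $A$ of a Banach space $Z$, $\omega(A)=\inf\{\widehat{\operatorname{d}}(A,K):\emptyset\ne K\subset Z\text{ weakly compact}\}$; for an operator $T:X\to Y$, $\omega(T)=\omega(T(B_X))$ (computed in $Y$). For a bounded set $F\subset X^*$, $q_F(x)=\sup_{x^*\in F}|x^*(x)|$. For a bounded sequence $(x_n)$ in $X$, $$\operatorname{ca}_\rho(x_n)=\sup_{F}\inf_{n_0}\sup_{i,j\ge n_0}q_F(x_i-x_j),$$ the supremum over all weakly compact $F\subset B_{X^*}$. For a bounded sequence $(x_n^* )$ in $X^*$, $$\operatorname{ca}_{\rho^*}(x_n^* )=\sup_{F}\inf_{n_0}\sup_{i,j\ge n_0}\sup_{x\in F}|(x_i^*-x_j^* )(x)|,$$ the first supremum over all weakly compact $F\subset B_X$. Finally $\widetilde{\operatorname{ca}}_\rho(x_n)$ (resp. $\widetilde{\operatorname{ca}}_{\rho^*}(x_n^*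 )$) is the infimum of $\operatorname{ca}_\rho$ (resp. $\operatorname{ca}_{\rho^*}$) over all subsequences of the given sequence. *)

(* Defs.v *)
From HB Require Import structures.
From mathcomp Require Import all_boot all_order all_algebra.
From mathcomp Require Import all_classical all_reals all_analysis.
From mathcomp Require Import complex.

Set Implicit Arguments.
Unset Strict Implicit.
Unset Printing Implicit Defensive.

Import Order.TTheory GRing.Theory Num.Theory.
Import numFieldNormedType.Exports.

Local Open Scope classical_set_scope.
Local Open Scope ring_scope.

Variant scalar_kind := RealScalars | ComplexScalars.

Definition scalars (R : realType) (k : scalar_kind) : numFieldType :=
  match k with RealScalars => R | ComplexScalars => R[i] end.

Definition to_real (R : realType) (k : scalar_kind) : scalars R k -> R :=
  match k return scalars R k -> R with
  | RealScalars => fun r => r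
  | ComplexScalars => @complex.Re R
  end.

Definition of_real (R : realType) (k : scalar_kind) : R -> scalars R k :=
  match k return R -> scalars R k with
  | RealScalars => fun r => r
  | ComplexScalars => real_complex R
  end.

Arguments to_real {R k}.
Arguments of_real {R} k.

(* In normedModType K the norm takes its values in K, hence in R[i] for complex
   spaces; rnorm is the same number seen in R (see norm_rnorm). *)
Definition rnorm (R : realType) (k : scalar_kind)
  (V : normedZmodType (scalars R k)) (v : V) : R := to_real `|v|.

Lemma complex_complete (R : realType) (F : set_system R[i]^o) :
  ProperFilter F -> cauchy F -> cvg F.
Proof.
move=> FF Fc.
have part_cvg (g : R[i]^o -> R) : (forall x y, g (x - y) = g x - g y) ->
    (forall z, (`|g z|%:C <= `|z|)%C) -> cvg (g @ F).
  move=> gB g_le; apply: R_complete; apply/cauchy_ballP => e e0; near_simpl.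
  have /cauchy_ballP/(_ e%:C%C) := Fc; rewrite ltcR => /(_ e0).
  apply: filterS => -[x y] /=; rewrite -!ball_normE /= -[_ < e]ltcR -gB.
  exact/le_lt_trans/g_le.
have /cvg_ex[a Fa] : cvg (@complex.Re R @ F).
  by apply: part_cvg => [[? ?] [? ?]//|z]; exact: normc_ge_Re.
have /cvg_ex[b Fb] : cvg (@complex.Im R @ F).
  apply: part_cvg => [[? ?] [? ?]//|z].
  by rewrite normc_def lecR -sqrtr_sqr ler_sqrt ?lerDr ?addr_ge0 ?sqr_ge0.
apply/cvg_ex; exists (a +i* b)%C; apply/cvgrPdist_lt => e e0.
have er : e = (complex.Re e)%:C%C by apply: esym; exact/RRe_real/gtr0_real.
move: (e0); rewrite er ltcR => r0.
near=> z.
have -> : (a +i* b)%C - z =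
    (a - complex.Re z)%:C%C + 'i%C * (b - complex.Im z)%:C%C.
  by case: (z) => c d /=; rewrite complexiE; simpc.
rewrite (le_lt_trans (ler_normD _ _))// normrM.
have -> : `|'i%C : R[i]| = 1 by rewrite normc_def /= expr0n expr1n add0r sqrtr1.
have nC (r : R) : `|r%:C%C| = `|r|%:C%C by rewrite normc_def /= expr0n addr0 sqrtr_sqr.
rewrite mul1r !nC -rmorphD ltcR (splitr (complex.Re e)) ltrD//; near: z.
  by move/cvgrPdist_lt : Fa; apply; rewrite divr_gt0.
by move/cvgrPdist_lt : Fb; apply; rewrite divr_gt0.
Unshelve. all: by end_near. Qed.

Section scalars_theory.
Context {R : realType} {k : scalar_kind}.
Local Notation K := (scalars R k).
Implicit Types (r s : R) (V : normedZmodType K).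

Lemma of_realK r : to_real (of_real k r) = r.
Proof. by case: k. Qed.

Lemma to_realK (x : K) : x \is Num.real -> of_real k (to_real x) = x.
Proof.
rewrite /K; case: k x => //= x xr.
by move/complex_realP: xr => [r ->].
Qed.

Lemma of_realD r s : of_real k (r + s) = of_real k r + of_real k s.
Proof. by case: k => //=; exact: rmorphD. Qed.

Lemma of_realM r s : of_real k (r * s) = of_real k r * of_real k s.
Proof. by case: k => //=; exact: rmorphM. Qed.

Lemma of_real0 : of_real k (0 : R) = 0.
Proof. by case: k. Qed.

Lemma of_real1 : of_real k (1 : R) = 1.
Proof. by case: k. Qed.

Lemma ler_of_real r s : (of_real k r <= of_real k s) = (r <= s).
Proof. by case: k => //=; rewrite lecR. Qed.

Lemma ltr_of_real r s : (of_real k r < of_real k s) = (r < s).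
Proof. by case: k => //=; rewrite ltcR. Qed.

Lemma of_real_inj : injective (of_real k : R -> K).
Proof. exact: can_inj of_realK. Qed.

Lemma of_real_real r : of_real k r \is Num.real.
Proof.
by rewrite realE -of_real0 !ler_of_real -realE num_real.
Qed.

Lemma norm_rnorm V (v : V) : `|v| = of_real k (rnorm v).
Proof. by rewrite /rnorm to_realK// normr_real. Qed.

Lemma rnorm_ge0 V (v : V) : 0 <= rnorm v.
Proof. by rewrite -ler_of_real -norm_rnorm of_real0. Qed.

Lemma ler_rnormD V (v w : V) : rnorm (v + w) <= rnorm v + rnorm w.
Proof. by rewrite -ler_of_real of_realD -!norm_rnorm ler_normD. Qed.

Lemma rnormZ (X : normedModType K) (a : K) (x : X) :
  rnorm (a *: x) = rnorm a * rnorm x.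
Proof. by apply: of_real_inj; rewrite of_realM -!norm_rnorm normrZ. Qed.

Lemma rnorm_of_real (r : R) : rnorm (of_real k r) = `|r|.
Proof.
have [r0|r0] := leP 0 r.
  rewrite ger0_norm//; apply: of_real_inj.
  by rewrite -norm_rnorm ger0_norm// -of_real0 ler_of_real.
rewrite ltr0_norm//; apply: of_real_inj; rewrite -norm_rnorm ltr0_norm.
  by apply/eqP; rewrite eq_sym -subr_eq0 opprK -of_realD addNr of_real0.
by rewrite -of_real0 ltr_of_real.
Qed.

Lemma rnorm0_eq0 V (v : V) : rnorm v = 0 -> v = 0.
Proof. by move=> v0; apply/normr0_eq0; rewrite norm_rnorm v0 of_real0. Qed.

Lemma scalars_complete (F : set_system K^o) :
  ProperFilter F -> cauchy F -> cvg F.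
Proof.
by rewrite /K; case: k F => F; [exact: R_complete|exact: complex_complete].
Qed.

Lemma rnorm_le1 V (v : V) : (rnorm v <= 1) = (`|v| <= 1).
Proof. by rewrite norm_rnorm -of_real1 ler_of_real. Qed.

Lemma linear_continuousP (X Y : normedModType K) (f : {linear X -> Y}) :
  continuous f <-> exists C : R, forall x, rnorm (f x) <= C * rnorm x.
Proof.
rewrite -linear_bounded_continuous linear_boundedP; split.
  move=> /pinfty_ex_gt0[r r0 fr]; exists (to_real r) => x.
  rewrite -ler_of_real of_realM to_realK ?gtr0_real//.
  by rewrite -!norm_rnorm; exact: fr.
move=> [C fC]; near=> r => x.
rewrite norm_rnorm (le_trans (y := of_real k (C * rnorm x)))// ?ler_of_real//.
rewrite of_realM -norm_rnorm ler_wpM2r//; near: r; apply: nbhs_pinfty_ge.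
exact: of_real_real.
Unshelve. all: by end_near. Qed.

End scalars_theory.

Definition unit_ball (K : numFieldType) (X : normedModType K) : set X :=
  [set x | `|x| <= 1].
Arguments unit_ball {K} X.

Definition functional (K : numFieldType) (X : normedModType K) :
  {pred X -> K^o} := mem [set f | linear f /\ continuous f].

Record dual (R : realType) (k : scalar_kind)
  (X : normedModType (scalars R k)) := Dual {
  dual_fun :> X -> (scalars R k)^o;
  dual_funP : dual_fun \in @functional _ X }.

Section dual_normed.
Context {R : realType} {k : scalar_kind}.
Local Notation K := (scalars R k).
Variable X : normedModType K.

HB.instance Definition _ := [isSub for @dual_fun R k X].
HB.instance Definition _ := [Choice of dual X by <:].

Lemma functional_submod_closed : submod_closed (@functional _ X).
Proof.
split=> [|a f g].
  by rewrite inE; split=> [b x y|]; [rewrite scaler0 addr0|exact: cst_continuous].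
rewrite !inE => -[lf cf] [lg cg]; split=> [b x y|x].
  rewrite !fctE /= lf lg !scalerDr !scalerA (mulrC a b) -!addrA.
  by congr +%R; rewrite addrCA.
by apply: cvgD; [apply: cvgZl_tmp; exact: cf|exact: cg].
Qed.

HB.instance Definition _ :=
  GRing.isSubmodClosed.Build _ _ (@functional _ X) functional_submod_closed.
HB.instance Definition _ := [SubChoice_isSubLmodule of dual X by <:].

Lemma dual_linear (f : dual X) : linear f.
Proof. by have := dual_funP f; rewrite inE => -[]. Qed.

HB.instance Definition _ (f : dual X) :=
  GRing.isLinear.Build K X K^o *:%R f (@dual_linear f).

Lemma dual_continuous (f : dual X) : continuous f.
Proof. by have := dual_funP f; rewrite inE => -[]. Qed.

Lemma dualP (f g : dual X) : f = g <-> f =1 g.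
Proof. by split=> [->//|fg]; apply/val_inj/funext. Qed.

Lemma dualDE (f g : dual X) x : (f + g) x = f x + g x. Proof. by []. Qed.
Lemma dualBE (f g : dual X) x : (f - g) x = f x - g x. Proof. by []. Qed.
Lemma dualZE (a : K) (f : dual X) x : (a *: f) x = a *: f x. Proof. by []. Qed.

Definition dual_norm (f : dual X) : R := sup [set rnorm (f x) | x in unit_ball X].

Lemma dual_norm_has_ubound (f : dual X) :
  has_ubound [set rnorm (f x) | x in unit_ball X].
Proof.
have /linear_continuousP[C fC] := @dual_continuous f.
exists `|C| => _ [x x1 <-]; rewrite (le_trans (fC x))//.
rewrite (le_trans (ler_wpM2r (rnorm_ge0 x) (ler_norm C)))// ler_piMr//.
by rewrite rnorm_le1.
Qed.

Lemma dual_norm_ub (f : dual X) x : rnorm (f x) <= dual_norm f * rnorm x.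
Proof.
have [->|x0] := eqVneq x 0.
  by rewrite raddf0 /rnorm !normr0 -(of_real0 (k := k)) of_realK mulr0.
have rx0 : 0 < rnorm x.
  by rewrite lt0r rnorm_ge0 andbT; apply: contra_neq x0 => /rnorm0_eq0.
rewrite -ler_pdivrMr// mulrC.
apply: ub_le_sup; first exact: dual_norm_has_ubound.
exists (of_real k (rnorm x)^-1 *: x).
  rewrite /unit_ball/= norm_rnorm rnormZ rnorm_of_real ger0_norm ?invr_ge0 ?rnorm_ge0//.
  by rewrite mulVf ?gt_eqF// of_real1.
by rewrite linearZ/= rnormZ rnorm_of_real ger0_norm// invr_ge0 rnorm_ge0.
Qed.

Lemma dual_norm_le (f : dual X) (C : R) : 0 <= C ->
  (forall x, rnorm (f x) <= C * rnorm x) -> dual_norm f <= C.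
Proof.
move=> C0 fC; apply: ge_sup.
  by exists (rnorm (f 0)), 0 => //; rewrite /unit_ball/= normr0.
move=> _ [x x1 <-]; rewrite (le_trans (fC x))// ler_piMr//.
by rewrite rnorm_le1.
Qed.

Lemma dual_norm_ge0 (f : dual X) : 0 <= dual_norm f.
Proof.
rewrite (le_trans (rnorm_ge0 (f 0)))//; apply: ub_le_sup.
  exact: dual_norm_has_ubound.
by exists 0 => //; rewrite /unit_ball/= normr0.
Qed.

Lemma ler_dual_normD (f g : dual X) :
  of_real k (dual_norm (f + g)) <= of_real k (dual_norm f) + of_real k (dual_norm g).
Proof.
rewrite -of_realD ler_of_real; apply: dual_norm_le => [|x].
  by rewrite addr_ge0 ?dual_norm_ge0.
by rewrite dualDE (le_trans (ler_rnormD _ _))// mulrDl lerD ?dual_norm_ub.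
Qed.

Lemma dual_normZ (a : K) (f : dual X) :
  of_real k (dual_norm (a *: f)) = `|a| * of_real k (dual_norm f).
Proof.
have le b g : dual_norm (b *: g) <= rnorm b * dual_norm g.
  apply: dual_norm_le => [|x].
    by rewrite mulr_ge0 ?rnorm_ge0 ?dual_norm_ge0.
  by rewrite dualZE rnormZ -mulrA ler_wpM2l ?rnorm_ge0 ?dual_norm_ub.
rewrite norm_rnorm -of_realM; congr of_real; apply/eqP; rewrite eq_le le/=.
have [->|a0] := eqVneq a 0.
  by rewrite /rnorm normr0 -(of_real0 (k := k)) of_realK mul0r dual_norm_ge0.
have ra0 : 0 < rnorm a.
  by rewrite lt0r rnorm_ge0 andbT; apply: contra_neq a0 => /rnorm0_eq0.
rewrite -ler_pdivlMl//.
have -> : (rnorm a)^-1 = rnorm a^-1.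
  apply: (mulfI (lt0r_neq0 ra0)); rewrite mulfV ?gt_eqF//.
  apply: (@of_real_inj R k); rewrite of_realM -!norm_rnorm -normrM.
  by rewrite mulfV// normr1 of_real1.
by rewrite -[in leLHS](scalerK a0 f) le.
Qed.

Lemma dual_norm0_eq0 (f : dual X) : of_real k (dual_norm f) = 0 -> f = 0.
Proof.
rewrite -(of_real0 (k := k)) => /of_real_inj f0; apply/dualP => x.
apply/rnorm0_eq0/eqP; rewrite eq_le rnorm_ge0 andbT.
by rewrite (le_trans (dual_norm_ub f x))// f0 mul0r.
Qed.

HB.instance Definition _ := Lmodule_isNormed.Build K (dual X)
  ler_dual_normD dual_normZ dual_norm0_eq0.

Lemma rnorm_dual (f : dual X) : rnorm f = dual_norm f.
Proof. exact: of_realK. Qed.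

Lemma dual_complete (F : set_system (dual X)) :
  ProperFilter F -> cauchy F -> cvg F.
Proof.
move=> FF /cauchy_ballP Fc.
have FcR (e : R) : 0 < e ->
    \forall f \near F, \forall h \near F, dual_norm (f - h) < e.
  move=> e0; apply: nearP_dep.
  have := Fc (of_real k e); rewrite -{1}(of_real0 (k := k)) ltr_of_real => /(_ e0).
  apply: filterS => -[f h] /=; rewrite -ball_normE/=.
  by rewrite norm_rnorm ltr_of_real rnorm_dual.
have pt x : cvg ((fun f : dual X => f x) @ F).
  apply: scalars_complete; apply/cauchy_ballP => e e0; near_simpl.
  have [er re] : e = of_real k (to_real e) /\ 0 < to_real e.
    have -> : e = of_real k (to_real e) by rewrite to_realK// gtr0_real.
    by rewrite of_realK -(ltr_of_real (k := k)) of_real0 to_realK ?gtr0_real.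
  have x1 : 0 < rnorm x + 1 by rewrite ltr_wpDl ?rnorm_ge0.
  have := Fc (of_real k (to_real e / (rnorm x + 1))).
  rewrite -{1}(of_real0 (k := k)) ltr_of_real divr_gt0// => /(_ isT).
  apply: filterS => -[f h] /=; rewrite -!ball_normE/= => fh.
  move: fh; rewrite er !norm_rnorm !ltr_of_real rnorm_dual ltr_pdivlMr// -er.
  apply: le_lt_trans; rewrite -dualBE (le_trans (dual_norm_ub _ _))//.
  by rewrite ler_wpM2l ?dual_norm_ge0// lerDl.
pose g (x : X) : K^o := lim ((fun f : dual X => f x) @ F).
have gE x : (fun f : dual X => f x) @ F --> g x by exact: pt.
have lg : linear g.
  move=> a x y; apply/cvg_lim; first exact: norm_hausdorff.
  under eq_fun do rewrite linearP.
  by apply: cvgD; [apply: cvgZl_tmp; exact: gE|exact: gE].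
have key (e : R) : 0 < e ->
    \forall f \near F, forall x, rnorm ((f : dual X) x - g x) <= e * rnorm x.
  move=> e0; apply: filterS (FcR e e0) => f fh x.
  apply/ler_addgt0Pr => d d0.
  have d0' : 0 < of_real k d by rewrite -(of_real0 (k := k)) ltr_of_real.
  have /cvgrPdist_lt/(_ _ d0') gd := gE x.
  have [h [/= h1]] := filter_ex (filterI fh gd).
  rewrite distrC norm_rnorm ltr_of_real => h2.
  rewrite (_ : f x - g x = (f - h) x + (h x - g x)); last first.
    by rewrite dualBE addrA subrK.
  rewrite (le_trans (ler_rnormD _ _))// lerD// ?(ltW h2)//.
  by rewrite (le_trans (dual_norm_ub _ _))// ler_wpM2r ?rnorm_ge0 ?ltW.
have cg : continuous g.
  pose gl := GRing.isLinear.Build K X K^o *:%R g lg.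
  pose G : {linear X -> K^o} := HB.pack g gl.
  apply/(linear_continuousP G).
  have [f fg] := filter_ex (key 1 ltr01).
  exists (dual_norm f + 1) => x; rewrite mulrDl /=.
  rewrite (_ : g x = f x - (f x - g x)); last by rewrite opprB addrC subrK.
  rewrite (le_trans (ler_rnormD _ _))// lerD ?dual_norm_ub//.
  by rewrite (le_trans _ (fg x))// /rnorm normrN.
have gP : g \in @functional _ X by rewrite inE; split.
apply/cvg_ex; exists (Dual gP); apply/cvgrPdist_le => e e0.
have er : e = of_real k (to_real e) by rewrite to_realK// gtr0_real.
have re : 0 < to_real e by rewrite -(ltr_of_real (k := k)) -er of_real0.
apply: filterS (key _ re) => f fg.
rewrite distrC er norm_rnorm ler_of_real rnorm_dual.
by apply: dual_norm_le => [|x]; [rewrite ltW|exact: fg].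
Qed.

HB.instance Definition _ := Uniform_isComplete.Build (dual X) dual_complete.

End dual_normed.

(* Continuity is boundedness here; see linear_continuousP. *)
Record operator (K : numFieldType) (X Y : normedModType K) := Operator {
  op_fun :> {linear X -> Y};
  op_continuous : continuous op_fun }.

Section adjoint.
Context {R : realType} {k : scalar_kind}.
Local Notation K := (scalars R k).
Context {X Y : normedModType K}.
Variable T : operator X Y.

Lemma adjoint_subproof (f : dual Y) : (f \o T : X -> K^o) \in @functional _ X.
Proof.
rewrite inE; split=> [a x y|x]; first by rewrite /= !linearP.
by apply: continuous_comp; [exact: op_continuous|exact: dual_continuous].
Qed.

Definition adjoint_fun (f : dual Y) : dual X := Dual (adjoint_subproof f).

Lemma adjoint_linear : linear adjoint_fun.
Proof. by move=> a f g; apply/dualP. Qed.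

HB.instance Definition _ :=
  GRing.isLinear.Build K (dual Y) (dual X) *:%R adjoint_fun adjoint_linear.

Lemma adjoint_continuous : continuous adjoint_fun.
Proof.
have /linear_continuousP[C TC] := @op_continuous _ _ _ T.
apply/linear_continuousP; exists `|C| => f; rewrite !rnorm_dual.
apply: dual_norm_le => [|x]; first by rewrite mulr_ge0 ?dual_norm_ge0.
rewrite (le_trans (dual_norm_ub f (T x)))// [leRHS]mulrAC [leRHS]mulrC ler_wpM2l ?dual_norm_ge0//.
by rewrite (le_trans (TC x))// ler_wpM2r ?rnorm_ge0 ?ler_norm.
Qed.

Definition adjoint : operator (dual Y) (dual X) := Operator adjoint_continuous.

End adjoint.

Section weak_topology.
Context {R : realType} {k : scalar_kind}.
Local Notation K := (scalars R k).

Definition evaluation (X : normedModType K) (x : X) : {ptws dual X -> K^o} :=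
  fun f => f x.

(* The coarsest topology making all f : dual X continuous; see
   weak_cvgP. *)
Definition weak (X : normedModType K) : Type := initial_topology (@evaluation X).

HB.instance Definition _ (X : normedModType K) := Pointed.on (weak X).
HB.instance Definition _ (X : normedModType K) := Uniform.on (weak X).

Definition weakly_cvg (X : normedModType K) (x_ : nat -> X) (x : X) : Prop :=
  (x_ : nat -> weak X) @ \oo --> (x : weak X).

Definition weakly_cauchy (X : normedModType K) (x_ : nat -> X) : Prop :=
  forall f : dual X, cauchy ((f \o x_) @ \oo).

Definition weakly_compact (X : normedModType K) (A : set X) : Prop :=
  compact (A : set (weak X)).

Lemma weak_cvgP (X : normedModType K) (F : set_system X) (FF : Filter F) (x : X) :
  F --> (x : weak X) <-> forall f : dual X, f @ F --> f x.
Proof.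
split=> [Fx f|Fx].
  apply: (cvg_comp (evaluation (X := X)) (proj f)); last first.
    exact: (@proj_continuous _ (fun=> K^o) f (evaluation x)).
  apply: cvg_trans (initial_continuous (f := @evaluation X) (x := x)).
  exact: cvg_app.
have eF : (evaluation (X := X)) @ F --> (evaluation x : {ptws dual X -> K^o}).
  apply/cvg_sup => f; apply/cvg_image.
    by rewrite eqEsubset; split=> // c _; exists (fun=> c).
  move=> A /Fx fA.
  exists (proj f @^-1` A) => //; rewrite image_preimage// eqEsubset.
  by split=> // c _; exists (fun=> c).
move=> A; rewrite nbhsE => -[_ [[C oC <-] /= Cx] /filterS]; apply.
by apply: eF; exact: open_nbhs_nbhs.
Qed.

Lemma weakly_cvgP (X : normedModType K) (x_ : nat -> X) (x : X) :
  weakly_cvg x_ x <-> forall f : dual X, (f \o x_) @ \oo --> f x.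
Proof. exact: weak_cvgP. Qed.

End weak_topology.

Section quantities.
Context {R : realType} {k : scalar_kind}.
Local Notation K := (scalars R k).
Local Open Scope ereal_scope.

Definition tail_sup (d : nat -> nat -> \bar R) : \bar R :=
  ereal_inf [set ereal_sup
    [set d i j | i in [set i | (n <= i)%N] & j in [set j | (n <= j)%N]]
    | n in [set: nat]].

Definition ca (Z : normedModType K) (z_ : nat -> Z) : \bar R :=
  tail_sup (fun i j => (rnorm (z_ i - z_ j)%R)%:E).

Definition cc (X Y : normedModType K) (T : operator X Y) : \bar R :=
  ereal_sup [set ca (T \o x_) | x_ in
    [set x_ : nat -> X | weakly_cauchy x_ /\ forall n, unit_ball X (x_ n)]].

Definition dhat (Z : normedModType K) (A B : set Z) : \bar R :=
  ereal_sup [set ereal_inf [set (rnorm (a - b)%R)%:E | b in B] | a in A].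

Definition omega (Z : normedModType K) (A : set Z) : \bar R :=
  ereal_inf [set dhat A B | B in [set B | B !=set0 /\ weakly_compact B]].

Definition omega_op (X Y : normedModType K) (T : operator X Y) : \bar R :=
  omega (T @` unit_ball X).

Definition q (X : normedModType K) (F : set (dual X)) (x : X) : \bar R :=
  ereal_sup [set (rnorm (f x))%:E | f in F].

Definition q_star (X : normedModType K) (F : set X) (f : dual X) : \bar R :=
  ereal_sup [set (rnorm (f x))%:E | x in F].

(* For F = set0 the inner supremum is -oo rather than 0; this does not affect
   the outer supremum, to which F = [set 0] contributes 0. *)
Definition ca_rho (X : normedModType K) (x_ : nat -> X) : \bar R :=
  ereal_sup [set tail_sup (fun i j => q F (x_ i - x_ j)%R) | F in
    [set F | weakly_compact F /\ F `<=` unit_ball (dual X)]].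

Definition ca_rho_star (X : normedModType K) (f_ : nat -> dual X) : \bar R :=
  ereal_sup [set tail_sup (fun i j => q_star F (f_ i - f_ j)%R) | F in
    [set F | weakly_compact F /\ F `<=` unit_ball X]].

Definition subsequences (T : Type) (u_ : nat -> T) : set (nat -> T) :=
  [set u_ \o phi | phi in
    [set phi : nat -> nat | {homo phi : m n / (m < n)%N}]].

Definition ca_rho_tilde (X : normedModType K) (x_ : nat -> X) : \bar R :=
  ereal_inf [set ca_rho y_ | y_ in subsequences x_].

Definition ca_rho_star_tilde (X : normedModType K) (f_ : nat -> dual X)
  : \bar R := ereal_inf [set ca_rho_star g_ | g_ in subsequences f_].

End quantities.

Section dunford_pettis.
Context {R : realType} {k : scalar_kind}.
Local Notation K := (scalars R k).

(* precompact means that the closure, here the weak closure, is compact. *)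
Definition weakly_compact_op (X Y : normedModType K) (T : operator X Y) : Prop :=
  precompact (T @` unit_ball X : set (weak Y)).

Definition completely_continuous (X Y : normedModType K) (T : operator X Y)
  : Prop :=
  forall x_ : nat -> X, (exists x, weakly_cvg x_ x) ->
    exists y : Y, (T \o x_) @ \oo --> y.

Definition dunford_pettis (X : completeNormedModType K) : Prop :=
  forall (Y : completeNormedModType K) (T : operator X Y),
    weakly_compact_op T -> completely_continuous T.

End dunford_pettis.

(* Main.v *)
Require Import Defs.
From HB Require Import structures.
From mathcomp Require Import all_boot all_order all_algebra.
From mathcomp Require Import all_classical all_reals all_analysis.
From mathcomp Require Import complex ring lra.

(** All the assertions are compared with one statement on sequences, symmetric
    in [X] and [dual X]: if [x_] and [f_] are bounded and weakly null in [X] and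
    in [dual X], then [f_ n (x_ n)] tends to [0]. It is called
    [dunford_pettis_pairing (dual_pairing X)] below; the record [pairing] is
    there so that an argument about [X] and [dual X] also serves with the two
    spaces exchanged.

    From this statement to the inequalities. Let a sequence [v] lie within [c]
    of a weakly compact set, and choose points [w n] of that set with
    [rnorm (v n - w n) < c]. By the Eberlein-Smulian theorem [w] has a weakly
    convergent subsequence, and along it a weakly null [u] satisfies
    [w n (u n) --> 0]. So [v n (u n)] is eventually less than [c] times a bound
    of [u] ([pairing_omega]), which gives the two inequalities on upper limits.
    Those on [cc] follow on applying this to differences of terms of a weakly
    Cauchy sequence in the ball, whose norm may reach [2]. Those on
    [ca_rho_tilde] and [ca_rho_star_tilde] follow since [w] becomes, along the
    subsequence, uniformly Cauchy on every weakly compact set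
    ([pairing_subsequence]).

    From the inequalities to this statement. The range of a weakly null sequence
    together with [0] is weakly compact, so that [omega] vanishes on it; the
    last four inequalities then give the statement after scaling. For the
    inequality on [cc (adjoint T)] an operator into [X] is built from [x_]: the
    image of an element [g] of the bidual of the absolutely summable sequences
    is the sum of a series in the [x_ n] ([weakly_null_representation]), and the
    image of the ball is weakly compact.

    The Dunford-Pettis property and operators. The same construction applied to
    [f_] shows that the operator sending [x] to the bounded sequence [f_ n x] is
    weakly compact, and complete continuity of this operator is the statement on
    sequences. To recover the property from this statement, or from the
    inequality on [cc T], one uses Gantmacher's theorem: the adjoint of a weakly
    compact operator maps the ball onto a weakly compact set.

    The functional analysis is developed over both scalar fields at once:
    Hahn-Banach through minimal sublinear functionals, Alaoglu through
    ultrafilters, Goldstine through a nearest point argument, and uniform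
    boundedness through a gliding hump. *)

Import Order.TTheory GRing.Theory Num.Theory.
Import numFieldNormedType.Exports.

Set Implicit Arguments.
Unset Strict Implicit.
Unset Printing Implicit Defensive.

Local Open Scope classical_set_scope.
Local Open Scope ring_scope.

(** * Scalars, norms and ultrafilter limits *)

(** With this value over the reals, [scalar_decomp] and the complexification of
    real-linear functionals read the same over both fields. *)
Definition iota_unit (R : realType) (k : scalar_kind) : scalars R k :=
  match k with RealScalars => 0 | ComplexScalars => 'i%C end.

Section scalars.
Context {R : realType} {k : scalar_kind}.
Local Notation K := (scalars R k).
Local Notation iota := (iota_unit R k).
Implicit Types (c d : K) (r s : R).

Lemma to_realD c d : to_real (c + d) = to_real c + to_real d.
Proof. by move: c d; rewrite /K; case: k => [|[a b] [a' b']]. Qed.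

Lemma to_realN c : to_real (- c) = - to_real c.
Proof. by move: c; rewrite /K; case: k => [|[a b]]. Qed.

Lemma to_realM r c : to_real (of_real k r * c) = r * to_real c.
Proof.
by move: c; rewrite /K; case: k => [|[a b]]//=; rewrite mul0r subr0.
Qed.

Lemma to_real0 : to_real (0 : K) = 0.
Proof. by rewrite -(of_real0 (k := k)) of_realK. Qed.

Lemma of_realN r : of_real k (- r) = - of_real k r.
Proof. by apply/eqP; rewrite -addr_eq0 -of_realD addNr of_real0. Qed.

(** Half of [`|to_real c| <= rnorm c]; the other half is this one for [- c]. *)
Lemma to_real_le c : to_real c <= rnorm (c : K^o).
Proof.
rewrite -(ler_of_real (k := k)) -norm_rnorm; move: c; rewrite /K.
case: k => [c|c] /=; first exact: ler_norm.
apply: le_trans (normc_ge_Re c).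
by rewrite lecR ler_norm.
Qed.

Lemma rnormM c d : rnorm (c * d : K^o) = rnorm (c : K^o) * rnorm (d : K^o).
Proof. exact: (rnormZ (X := K^o)). Qed.

Lemma rnormN (V : normedZmodType K) (v : V) : rnorm (- v) = rnorm v.
Proof. by rewrite /rnorm normrN. Qed.

Lemma rnorm0 (V : normedZmodType K) : rnorm (0 : V) = 0.
Proof. by rewrite /rnorm normr0 to_real0. Qed.

Lemma rnorm1 : rnorm (1 : K^o) = 1.
Proof. by rewrite -(of_real1 (k := k)) rnorm_of_real normr1. Qed.

Lemma rnorm_gt0 (V : normedZmodType K) (v : V) : v != 0 -> 0 < rnorm v.
Proof.
by move=> v0; rewrite lt0r rnorm_ge0 andbT; apply: contra_neq v0 => /rnorm0_eq0.
Qed.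

Lemma rnormB (V : normedZmodType K) (v w : V) : rnorm (v - w) = rnorm (w - v).
Proof. by rewrite -rnormN opprB. Qed.

Lemma ler_rnormB (V : normedZmodType K) (v w : V) :
  rnorm (v - w) <= rnorm v + rnorm w.
Proof. by rewrite (le_trans (ler_rnormD _ _))// rnormN. Qed.

Lemma rnorm_subr (V : normedZmodType K) (v w : V) :
  rnorm v <= rnorm (v - w) + rnorm w.
Proof. by rewrite (le_trans _ (ler_rnormD _ _))// subrK. Qed.

Lemma rnorm_iota : rnorm (iota : K^o) <= 1.
Proof.
rewrite -(ler_of_real (k := k)) -norm_rnorm of_real1 /K /iota_unit; case: k => /=.
  by rewrite normr0 ler01.
by rewrite normc_def /= expr0n expr1n add0r sqrtr1.
Qed.

Lemma scalar_decomp c :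
  c = of_real k (to_real c) - iota * of_real k (to_real (iota * c)).
Proof.
move: c; rewrite /K /iota_unit; case: k => [c|[a b]] /=; first by rewrite mul0r subr0.
rewrite complexiE; simpc. by [].
Qed.

Lemma iota_sqr : iota = 0 \/ iota * iota = -1.
Proof.
rewrite /K /iota_unit; case: k; [by left|right].
by rewrite -sqr_i expr2.
Qed.

(** Rotating by [u] turns a bound on real parts into a bound on moduli. *)
Lemma unimodular c : exists2 u : K, rnorm (u : K^o) = 1 &
  u * c = of_real k (rnorm (c : K^o)).
Proof.
have [->|c0] := eqVneq c 0.
  by exists 1; rewrite ?rnorm1// mulr0 rnorm0 of_real0.
have r0 : rnorm (c : K^o) != 0 by rewrite gt_eqF ?(@rnorm_gt0 K^o).
exists (of_real k (rnorm (c : K^o)) / c); last by rewrite divfK.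
apply: (mulIf r0); rewrite -rnormM mul1r divfK// rnorm_of_real.
by rewrite ger0_norm ?rnorm_ge0.
Qed.

Lemma cvg_rnormP (V : normedModType K) T (F : set_system T) (FF : Filter F)
    (u : T -> V) (l : V) :
  u @ F --> l <-> forall e : R, 0 < e -> \forall t \near F, rnorm (u t - l) < e.
Proof.
split=> [/cvgrPdist_lt ul e e0|ul].
  have e0' : 0 < of_real k e by rewrite -(of_real0 (k := k)) ltr_of_real.
  apply: filterS (ul _ e0') => t.
  by rewrite norm_rnorm ltr_of_real rnormB.
apply/cvgrPdist_lt => e e0.
have er : e = of_real k (to_real e) by rewrite to_realK// gtr0_real.
have re : 0 < to_real e by rewrite -(ltr_of_real (k := k)) -er of_real0.
by apply: filterS (ul _ re) => t ut; rewrite er norm_rnorm ltr_of_real rnormB.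
Qed.

Lemma lim_rnorm_le (V : normedModType K) T (F : set_system T)
    (FF : ProperFilter F) (u : T -> V) (l : V) (M : R) :
  u @ F --> l -> (\forall t \near F, rnorm (u t) <= M) -> rnorm l <= M.
Proof.
move=> /cvg_rnormP ul uM; apply/ler_addgt0Pr => e e0.
have [t [/= ut1 ut2]] := filter_ex (filterI (ul e e0) uM).
rewrite (le_trans (rnorm_subr _ (u t)))// addrC lerD// rnormB.
exact: ltW.
Qed.

Lemma ultra_fmap T U (f : T -> U) (F : set_system T) :
  UltraFilter F -> UltraFilter (f @ F).
Proof.
move=> FU; split=> [|G GF fG]; first exact: fmap_proper_filter.
rewrite eqEsubset; split=> // A GA.
have [//|FnA] := in_ultra_setVsetC (f @^-1` A) FU.
have GnA : G (~` A) by apply: fG.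
by have [x []] := filter_ex (filterI GA GnA).
Qed.

Lemma ultra_bounded_cvg_real T (F : set_system T) (u : T -> R) (M : R) :
  UltraFilter F -> (\forall t \near F, `|u t| <= M) ->
  exists l : R, u @ F --> l.
Proof.
move=> FU uM; have := @segment_compact R (- M) M.
rewrite compact_ultra => /(_ (u @ F)) [].
- exact: ultra_fmap.
- by rewrite /fmap/=; apply: filterS uM => t; rewrite /= in_itv/= ler_norml.
by move=> l [_ ul]; exists l.
Qed.

(** Bounded scalars converge along an ultrafilter: this is where compactness of
    balls of the scalar field enters, through real and imaginary parts. *)
Lemma ultra_bounded_cvg T (F : set_system T) (u : T -> K^o) (M : R) :
  UltraFilter F -> (\forall t \near F, rnorm (u t) <= M) ->
  exists l : K^o, u @ F --> l.
Proof.
move=> FU uM; have FF := @ultra_proper _ _ FU.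
have part c : `|to_real c| <= rnorm (c : K^o).
  rewrite ler_norml to_real_le andbT lerNl -to_realN -[leRHS](@rnormN K^o).
  exact: to_real_le.
have [a ua] : exists a : R, (to_real \o u) @ F --> a.
  apply: (@ultra_bounded_cvg_real _ _ _ M) => //.
  by apply: filterS uM => t; exact/le_trans/part.
have [b ub] : exists b : R, (fun t => to_real (iota * u t)) @ F --> b.
  apply: (@ultra_bounded_cvg_real _ _ _ M) => //.
  apply: filterS uM => t; apply/le_trans; rewrite (le_trans (part _))//.
  by rewrite rnormM ler_piMl ?rnorm_ge0 ?rnorm_iota.
exists (of_real k a - iota * of_real k b); apply/cvg_rnormP => e e0.
have e2 : 0 < e / 2 by rewrite divr_gt0.
move/cvgrPdist_lt/(_ _ e2) : ua => ua; move/cvgrPdist_lt/(_ _ e2) : ub => ub.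
apply: filterS2 ua ub => t /= ta tb.
rewrite (_ : u t - _ = of_real k (to_real (u t) - a)
   - iota * of_real k (to_real (iota * u t) - b)); last first.
  rewrite {1}(scalar_decomp (u t)) !of_realD !of_realN; ring.
rewrite (le_lt_trans (ler_rnormB _ _))// (splitr e) ltr_leD//.
  by rewrite rnorm_of_real distrC.
rewrite rnormM rnorm_of_real distrC (le_trans _ (ltW tb))//.
by rewrite ler_piMl// rnorm_iota.
Qed.

End scalars.

(** * The Hahn-Banach theorem *)

Section hahn_banach.
Context {R : realType} {k : scalar_kind}.
Local Notation K := (scalars R k).
Local Notation iota := (iota_unit R k).

Definition sublinear (X : lmodType K) (p : X -> R) :=
  (forall x y, p (x + y) <= p x + p y) /\
  (forall t x, 0 <= t -> p (of_real k t *: x) <= t * p x).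

Lemma sublinear0 (X : lmodType K) (p : X -> R) : sublinear p -> p 0 = 0.
Proof.
move=> [pD pZ]; apply/eqP; rewrite eq_le; apply/andP; split.
  by have := pZ 0 0 (lexx _); rewrite scaler0 mul0r.
by have := pD 0 0; rewrite addr0 lerDl.
Qed.

Lemma sublinearN (X : lmodType K) (p : X -> R) x : sublinear p -> - p (- x) <= p x.
Proof.
move=> sp; rewrite lerNl -subr_ge0 opprK -(sublinear0 sp) -(addNr x).
by case: sp => + _; exact.
Qed.

(** Replacing [p] by [directional p y] makes it linear along [y]: the new value
    at [- y] is at most [- p y], as [t = 1] shows. *)
Definition directional (X : lmodType K) (p : X -> R) (y x : X) : R :=
  inf [set p (x + of_real k t *: y) - t * p y | t in [set t | 0 <= t]].

Lemma directional_lb (X : lmodType K) (p : X -> R) (y x : X) : sublinear p ->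
  lbound [set p (x + of_real k t *: y) - t * p y | t in [set t | 0 <= t]]
    (- p (- x)).
Proof.
move=> sp _ [t /= t0 <-]; case: (sp) => pD pZ.
have ty : t * p y <= p (of_real k t *: y).
  have [->|tn0] := eqVneq t 0.
    by rewrite mul0r of_real0 scale0r (sublinear0 sp).
  have tp : 0 < t by rewrite lt0r tn0.
  have := pZ t^-1 (of_real k t *: y).
  rewrite invr_ge0 t0 scalerA -of_realM mulVf// of_real1 scale1r => /(_ isT).
  by rewrite ler_pdivlMl.
have := pD (x + of_real k t *: y) (- x).
by rewrite addrAC subrr add0r; lra.
Qed.

Lemma directional_le (X : lmodType K) (p : X -> R) (y x : X) t : sublinear p ->
  0 <= t -> directional p y x <= p (x + of_real k t *: y) - t * p y.
Proof.
move=> sp t0; apply: ge_inf; last by exists t.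
by exists (- p (- x)); exact: directional_lb.
Qed.

Lemma le_directional (X : lmodType K) (p : X -> R) (y x : X) a :
  (forall t, 0 <= t -> a <= p (x + of_real k t *: y) - t * p y) ->
  a <= directional p y x.
Proof.
move=> ale; apply: lb_le_inf => [|_ [t t0 <-]]; last exact: ale.
by exists (p (x + of_real k 0 *: y) - 0 * p y), 0 => /=.
Qed.

Lemma directional_sublinear (X : lmodType K) (p : X -> R) (y : X) :
  sublinear p -> sublinear (directional p y).
Proof.
move=> sp; case: (sp) => pD pZ; split=> [x z|t x t0].
  rewrite -lerBlDr; apply: le_directional => t t0.
  rewrite lerBlDr [leRHS]addrC -lerBlDr; apply: le_directional => s s0.
  rewrite lerBlDr (le_trans (directional_le _ _ sp (addr_ge0 t0 s0)))//.
  have := pD (x + of_real k t *: y) (z + of_real k s *: y).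
  rewrite addrACA -scalerDl -of_realD mulrDl; lra.
have [->|tn0] := eqVneq t 0.
  rewrite of_real0 scale0r mul0r (le_trans (directional_le _ _ sp (lexx 0)))//.
  by rewrite of_real0 scale0r addr0 mul0r subr0 (sublinear0 sp).
have tp : 0 < t by rewrite lt0r tn0.
rewrite -ler_pdivrMl//; apply: le_directional => s s0.
rewrite ler_pdivrMl//.
rewrite (le_trans (directional_le _ _ sp (mulr_ge0 t0 s0)))//.
rewrite of_realM -scalerA -scalerDr mulrBr mulrA lerB//; exact: pZ.
Qed.

(** A chain of sublinear functionals below [p] has its pointwise infimum as a
    lower bound, so Zorn's lemma gives a minimal [q]. Being minimal, [q] equals
    [directional q y], which at [t = 1] says [q x + q y <= q (x + y)]: minimal
    sublinear functionals are additive. *)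
Lemma minimal_sublinear (X : lmodType K) (p : X -> R) : sublinear p ->
  exists g : X -> R, [/\ forall x, g x <= p x,
    forall x y, g (x + y) = g x + g y &
    forall t x, g (of_real k t *: x) = t * g x].
Proof.
move=> sp; pose T := {q : X -> R | sublinear q /\ forall x, q x <= p x}.
pose r (s t : T) := `[< forall x, sval t x <= sval s x >].
have [|||A Atot|[q [sq qp]] qmin] := @Zorn T r.
- by move=> t; apply/asboolP => x.
- move=> u v w /asboolP uv /asboolP vw; apply/asboolP => x.
  exact: le_trans (vw x) (uv x).
- move=> [u hu] [v hv] /asboolP uv /asboolP vu; apply: eq_exist.
  by apply/funext => x; apply/eqP; rewrite eq_le (uv x) (vu x).
- have [[u Au]|nA] := pselect (exists u, A u); last first.
    exists (exist _ p (conj sp (fun x => lexx (p x)))) => s As.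
    by exfalso; apply: nA; exists s.
  pose m x := inf [set sval v x | v in A].
  (* The bound [- p (- x)] keeps the infimum of the chain finite. *)
  have lbA x : lbound [set sval v x | v in A] (- p (- x)).
    move=> _ [[v [sv vp]] Av <-] /=.
    by rewrite (le_trans _ (sublinearN x sv))// lerN2.
  have m_le x v : A v -> m x <= sval v x.
    by move=> Av; apply: ge_inf; [exists (- p (- x)); exact: lbA|exists v].
  have le_m x a : (forall v, A v -> a <= sval v x) -> a <= m x.
    move=> av; apply: lb_le_inf => [|_ [v Av <-]]; last exact: av.
    by exists (sval u x), u.
  have sm : sublinear m.
    split=> [x y|t x t0].
      rewrite -lerBlDr; apply: (le_m _ _) => v Av; rewrite lerBlDr [leRHS]addrC -lerBlDr.
      apply: le_m => w Aw; rewrite lerBlDr.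
      have [/asboolP vw|/asboolP wv] := Atot _ _ Av Aw.
        rewrite (le_trans (m_le _ _ Aw))//; case: (svalP w) => -[wD _] _.
        by rewrite (le_trans (wD _ _))// addrC lerD2l vw.
      rewrite (le_trans (m_le _ _ Av))//; case: (svalP v) => -[vD _] _.
      by rewrite (le_trans (vD _ _))// addrC lerD2r wv.
    have [->|tn0] := eqVneq t 0.
      rewrite of_real0 scale0r mul0r (le_trans (m_le _ _ Au))//.
      by case: (svalP u) => /sublinear0 ->.
    have tp : 0 < t by rewrite lt0r tn0.
    rewrite -ler_pdivrMl//; apply: le_m => v Av; rewrite ler_pdivrMl//.
    rewrite (le_trans (m_le _ _ Av))//; case: (svalP v) => -[_ vZ] _.
    exact: vZ.
  have mp x : m x <= p x.
    by rewrite (le_trans (m_le _ _ Au))//; case: (svalP u).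
  exists (exist _ m (conj sm mp)) => s As; apply/asboolP => x /=; exact: m_le.
have qD x y : q (x + y) = q x + q y.
  case: (sq) => qD _; apply/eqP; rewrite eq_le qD /=.
  have dq z : directional q y z <= q z.
    rewrite (le_trans (directional_le _ _ sq (lexx 0)))//.
    by rewrite of_real0 scale0r addr0 mul0r subr0.
  have dp : sublinear (directional q y) /\ forall z, directional q y z <= p z.
    split; first exact: directional_sublinear.
    by move=> z; rewrite (le_trans (dq z)).
  have /(congr1 (fun s => sval s x))/= <- := qmin (exist _ _ dp) (asboolT dq).
  have := directional_le y x sq ler01.
  by rewrite of_real1 scale1r mul1r lerBrDr.
have qN x : q (- x) = - q x.
  by apply/eqP; rewrite -addr_eq0 -qD addNr (sublinear0 sq).
have qZ t x : 0 <= t -> q (of_real k t *: x) = t * q x.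
  move=> t0; apply/eqP; rewrite eq_le (sq.2 _ _ t0)/=.
  by have := sq.2 t (- x) t0; rewrite scalerN !qN mulrN lerN2.
exists q; split=> // t x; have [t0|/ltW t0] := leP 0 t; first exact: qZ.
rewrite -[in LHS](opprK t) of_realN scaleNr qN qZ ?oppr_ge0 ?mulNr ?opprK//.
Qed.

Lemma dual_exists (X : normedModType K) (f : X -> K^o) (C : R) : linear f ->
  (forall x, rnorm (f x) <= C * rnorm x) -> exists F : dual X, forall x, F x = f x.
Proof.
move=> lf fC.
pose fl : {linear X -> K^o} := HB.pack f (GRing.isLinear.Build K X K^o *:%R f lf).
have cf : continuous f by apply/(linear_continuousP fl); exists C.
have fP : f \in @functional _ X by rewrite inE; split.
by exists (Dual fP).
Qed.

Lemma operator_exists (X Y : normedModType K) (f : X -> Y) (C : R) : linear f ->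
  (forall x, rnorm (f x) <= C * rnorm x) ->
  exists T : operator X Y, forall x, T x = f x.
Proof.
move=> lf fC.
pose fl : {linear X -> Y} := HB.pack f (GRing.isLinear.Build K X Y *:%R f lf).
have cf : continuous fl by apply/(linear_continuousP fl); exists C.
by exists (Operator cf).
Qed.

(** Hahn-Banach: among the sublinear functionals below [directional p x0] pick a
    minimal, hence real-linear, one; its value at [x0] is forced since
    [directional p x0 (- x0) <= - p x0]. A real-linear [g] is the real part of
    the [K]-linear [g x - iota * g (iota *: x)], and rotating [f x] onto the
    positive axis bounds its modulus by [p x]. *)
Theorem seminorm_functional (X : normedModType K) (p : X -> R) (C : R) (x0 : X) :
  (forall x y, p (x + y) <= p x + p y) ->
  (forall (a : K) x, p (a *: x) = rnorm (a : K^o) * p x) ->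
  (forall x, p x <= C * rnorm x) ->
  exists f : dual X, (forall x, rnorm (f x) <= p x) /\ rnorm (f x0) = p x0.
Proof.
move=> pD pZ pC.
have sp : sublinear p.
  by split=> // t x t0; rewrite pZ rnorm_of_real ger0_norm.
have [g [gp gD gZ]] := minimal_sublinear (directional_sublinear x0 sp).
have gle x : g x <= p x.
  rewrite (le_trans (gp x))// (le_trans (directional_le _ _ sp (lexx 0)))//.
  by rewrite of_real0 scale0r addr0 mul0r subr0.
have gN x : g (- x) = - g x.
  by rewrite -scaleN1r -(of_real1 (k := k)) -of_realN gZ mulN1r.
have gx0 : p x0 <= g x0.
  have := gp (- x0); rewrite gN => /le_trans.
  move=> /(_ _ (directional_le _ _ sp ler01)).
  by rewrite of_real1 scale1r addNr (sublinear0 sp) mul1r sub0r lerN2.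
pose f (x : X) : K^o := of_real k (g x) - iota * of_real k (g (iota *: x)).
have fre x : to_real (f x) = g x.
  rewrite /f to_realD of_realK to_realN mulrC to_realM.
  have -> : to_real iota = 0 by rewrite /iota_unit; clear; case: k.
  by rewrite mulr0 subr0.
have flin : linear f.
  move=> c x y; rewrite /f gD scalerDr gD !of_realD.
  set a := to_real c; set b := to_real (iota * c).
  have gc z : g (c *: z) = a * g z - b * g (iota *: z).
    rewrite {1}(scalar_decomp c) scalerBl gD gN -/a -/b mulrC -scalerA !gZ.
    by [].
  rewrite scalerA (mulrC iota c) -scalerA !gc.
  suff : g (iota *: (iota *: x)) = - g x /\ iota * iota = -1 \/ iota = 0.
    rewrite {1}(scalar_decomp c) -/a -/b.
    have sE (u v : K) : u *: (v : K^o) = u * v by [].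
    rewrite sE !of_realD !of_realN !of_realM.
    case=> [[-> i2]|->].
      rewrite of_realN.
      transitivity (of_real k a * of_real k (g x) - of_real k b * of_real k (g (iota *: x))
       + of_real k (g y) - iota * (of_real k a * of_real k (g (iota *: x)))
       - iota * (of_real k b * of_real k (g x)) - iota * of_real k (g (iota *: y)));
       first by ring.
      transitivity (of_real k a * of_real k (g x) + (iota * iota) * of_real k b * of_real k (g (iota *: x))
       + of_real k (g y) - iota * (of_real k a * of_real k (g (iota *: x)))
       - iota * (of_real k b * of_real k (g x)) - iota * of_real k (g (iota *: y)));
       last by ring.
      by rewrite i2; ring.
    have := gZ 0 0; rewrite scaler0 mul0r scale0r => ->; rewrite of_real0; ring.
  have [->|i2] := iota_sqr (R := R) (k := k); [by right|left; split=> //].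
  by rewrite scalerA i2 scaleN1r gN.
have fle x : rnorm (f x) <= p x.
  have [u u1 uf] := unimodular (f x).
  rewrite -(of_realK (k := k) (rnorm (f x))) -uf.
  have -> : u * f x = f (u *: x).
    have f0 : f 0 = 0 by have := flin (-1) 0 0; rewrite scaler0 addr0 scaleN1r addNr.
    by have := flin u x 0; rewrite !addr0 f0 addr0.
  by rewrite fre (le_trans (gle _))// pZ u1 mul1r.
have [F FE] := dual_exists flin (fun x => le_trans (fle x) (pC x)).
exists F; split=> [x|]; rewrite FE//; apply/eqP; rewrite eq_le fle /=.
by rewrite (le_trans gx0)// -fre to_real_le.
Qed.

Corollary norming_functional (X : normedModType K) (x : X) :
  exists f : dual X, rnorm f <= 1 /\ rnorm (f x) = rnorm x.
Proof.
have [|||f [f1 fx]] := @seminorm_functional X (@rnorm R k X) 1 x.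
- exact: ler_rnormD.
- exact: rnormZ.
- by move=> y; rewrite mul1r.
exists f; split=> //; rewrite rnorm_dual; apply: dual_norm_le => // y.
by rewrite mul1r.
Qed.

End hahn_banach.

(** * Weak compactness: Alaoglu, Goldstine, Gantmacher *)

Section weak_compactness.
Context {R : realType} {k : scalar_kind}.
Local Notation K := (scalars R k).
Local Notation iota := (iota_unit R k).
Implicit Types X Y V W : normedModType K.

Lemma cvg_weak_unique T (F : set_system T) (FF : ProperFilter F) (u : T -> K^o)
    (a b : K^o) : u @ F --> a -> u @ F --> b -> a = b.
Proof.
by move=> ua ub; apply: (@cvg_unique K^o _ (u @ F)) => //; exact: norm_hausdorff.
Qed.

Lemma weakly_compact_ultra V (A : set V) T (F : set_system T) (u : T -> V) :
  weakly_compact A -> UltraFilter F -> (\forall t \near F, A (u t)) ->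
  exists2 y, A y & forall f : dual V, (f \o u) @ F --> f y.
Proof.
rewrite /weakly_compact compact_ultra => cA FU FA.
have [y [Ay uy]] := cA (u @ F) (ultra_fmap _ FU) FA.
exists y => // f; have FF := @ultra_proper _ _ FU.
exact: (@weak_cvgP _ _ _ (u @ F) _ y).1 uy f.
Qed.

Lemma weakly_compact_ultraP V (A : set V) :
  (forall F : set_system V, UltraFilter F -> F A ->
    exists2 y, A y & forall f : dual V, f @ F --> f y) ->
  weakly_compact A.
Proof.
move=> UA; rewrite /weakly_compact compact_ultra => F FU FA.
have [y Ay fy] := UA F FU FA.
exists y; split=> //.
by apply: (@weak_cvgP _ _ V F _ y).2.
Qed.

Lemma rnorm_app X (f : dual X) x : rnorm (f x) <= rnorm f * rnorm x.
Proof. by rewrite rnorm_dual dual_norm_ub. Qed.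

(** The pointwise limit along the ultrafilter exists because bounded scalars
    converge, and linearity and the bound pass to the limit. *)
Lemma alaoglu W T (F : set_system T) (u : T -> dual W) (M : R) :
  UltraFilter F -> (\forall t \near F, rnorm (u t) <= M) ->
  exists phi : dual W, rnorm phi <= M /\ forall w, (fun t => u t w) @ F --> phi w.
Proof.
move=> FU uM; have FF := @ultra_proper _ _ FU.
have M0 : 0 <= M.
  by have [t] := filter_ex uM; apply: le_trans; exact: rnorm_ge0.
have bd w : \forall t \near F, rnorm (u t w) <= M * rnorm w.
  apply: filterS uM => t ut; rewrite (le_trans (rnorm_app _ _))//.
  by rewrite ler_wpM2r ?rnorm_ge0.
pose f w : K^o := projT1 (cid (ultra_bounded_cvg FU (bd w))).
have fE w : (fun t => u t w) @ F --> f w.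
  by rewrite /f; case: cid.
have lf : linear f.
  move=> a x y; apply: (cvg_weak_unique FF (fE _)).
  under eq_fun do rewrite linearP.
  by apply: cvgD; [apply: cvgZl_tmp; exact: fE|exact: fE].
have fM w : rnorm (f w) <= M * rnorm w.
  exact: (lim_rnorm_le FF (fE w) (bd w)).
have [phi phiE] := dual_exists lf fM.
exists phi; split=> [|w]; last by rewrite phiE; exact: fE.
by rewrite rnorm_dual; apply: dual_norm_le => // x; rewrite phiE.
Qed.

(** The hypothesis says that [h] is weak-* to weak continuous, and the ball of a
    dual space is weak-* compact. Every weakly compact set constructed below
    arises in this way or from a weakly null sequence. *)
Lemma weak_star_image W Y (h : dual W -> Y) :
  (forall g : dual Y, exists w, forall phi, g (h phi) = phi w) ->
  weakly_compact (h @` unit_ball (dual W)).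
Proof.
move=> hw; apply: weakly_compact_ultraP => F FU FA.
have [y0 _] : (h @` unit_ball (dual W)) !=set0.
  by exists (h 0), 0 => //; rewrite /unit_ball/= normr0.
pose s y : dual W := if pselect (exists2 phi, unit_ball (dual W) phi & h phi = y)
  is left e then s2val (cid2 e) else 0.
have sP y : (h @` unit_ball (dual W)) y -> unit_ball (dual W) (s y) /\ h (s y) = y.
  by move=> hy; rewrite /s; case: pselect => // e; case: cid2.
have [|phi [phi1 sphi]] := @alaoglu W _ F s 1 FU.
  by apply: filterS FA => y /sP[]; rewrite rnorm_le1.
exists (h phi); first by exists phi => //; rewrite /unit_ball/= -rnorm_le1.
move=> g; have [w gw] := hw g; rewrite gw.
have FF := @ultra_proper _ _ FU.
apply: cvg_trans (sphi w); apply: near_eq_cvg.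
by apply: filterS FA => y /sP[_ hs]; rewrite -gw hs.
Qed.

Lemma bidual_subproof X (x : X) : (fun f : dual X => f x : K^o) \in @functional _ (dual X).
Proof.
have lf : linear (fun f : dual X => f x : K^o) by [].
have [|F FE] := @dual_exists R k (dual X) (fun f => f x) (rnorm x) lf.
  by move=> f; rewrite mulrC rnorm_app.
have := dual_funP F; suff -> : dual_fun F = (fun f : dual X => f x : K^o) by [].
exact/funext.
Qed.

Definition bidual X (x : X) : dual (dual X) := Dual (bidual_subproof x).

Lemma bidual_linear X : linear (@bidual X).
Proof. by move=> a x y; apply/dualP => f; rewrite /= linearP. Qed.

Lemma rnorm_bidual X (x : X) : rnorm (bidual x) = rnorm x.
Proof.
apply/eqP; rewrite eq_le; apply/andP; split.
  rewrite [leLHS]rnorm_dual; apply: dual_norm_le => [|f]; first exact: rnorm_ge0.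
  by rewrite mulrC; exact: (rnorm_app f x).
have [f [f1 <-]] := norming_functional x.
rewrite (le_trans (rnorm_app (bidual x) f))//.
by rewrite ler_piMr ?rnorm_ge0.
Qed.

(** Helly's argument in the finite-dimensional space of the values
    [to_real (h x)], [h <- H]: were these values at [phi] at distance
    [sqrt d > 0] from those at the ball, the vector [v] pointing to them from a
    nearly nearest [x] would define a functional [g] with
    [to_real (g z) <= to_real (phi g) - d / 2] on the ball. *)
Lemma goldstine_real X (phi : dual (dual X)) (H : seq (dual X)) (e : R) :
  rnorm phi <= 1 -> 0 < e ->
  exists x, rnorm x <= 1 /\
    forall h, h \in H -> `|to_real (phi h) - to_real (h x)| < e.
Proof.
move=> phi1 e0.
pose D x := \sum_(h <- H) (to_real (phi h) - to_real (h x)) ^+ 2.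
have D0 x : 0 <= D x by apply: sumr_ge0 => h _; exact: sqr_ge0.
pose d := inf [set D x | x in [set x | rnorm x <= 1]].
have dD x : rnorm x <= 1 -> d <= D x.
  by move=> x1; apply: ge_inf; [exists 0 => _ [y _ <-]|exists x].
have hi : has_inf [set D x | x in [set x | rnorm x <= 1]].
  split; first by exists (D 0), 0 => //=; rewrite rnorm0.
  by exists 0 => _ [y _ <-].
have [d0|d0] := ltP 0 d; last first.
  have [_ [x /= x1 <-]] := inf_adherent (exprn_gt0 2 e0) hi.
  rewrite -/d => De; exists x; split=> // h hH.
  rewrite -(ltr_pXn2r (n := 2)) ?nnegrE ?normr_ge0 ?(ltW e0)//.
  rewrite real_normK ?num_real// (le_lt_trans _ (lt_le_trans De _))//.
    rewrite /D (big_rem h)//= lerDl; apply: sumr_ge0 => i _; exact: sqr_ge0.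
  by rewrite gerDr.
exfalso.
pose C := \sum_(h <- H) (2 * rnorm h) ^+ 2.
have C0 : 0 <= C by apply: sumr_ge0 => h _; exact: sqr_ge0.
(* Small enough for the quadratic term of [D (x + t (z - x))] to cost only
   [d / 4] after division by [2 * t]; the same is allowed for [D x - d]. *)
pose t := Num.min 1 (d / (2 * (C + 1))).
have t0 : 0 < t by rewrite lt_min ltr01 divr_gt0// mulr_gt0// ltr_wpDl.
have t1 : t <= 1 by rewrite ge_min lexx.
have tC : t * C <= d / 2.
  have : t <= d / (2 * (C + 1)) by rewrite ge_min lexx orbT.
  rewrite ler_pdivlMr ?mulr_gt0 ?ltr_wpDl// => tC.
  nra.
have [_ [x /= x1 <-]] := inf_adherent (mulr_gt0 t0 (divr_gt0 d0 (ltr0n _ 2))) hi.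
rewrite -/d => Dx.
pose v h := to_real (phi h) - to_real (h x).
pose g : dual X := \sum_(h <- H) of_real k (v h) *: h.
have gE z : to_real (g z) = \sum_(h <- H) v h * to_real (h z).
  rewrite /g; elim: (H) => [|h s IH]; first by rewrite !big_nil to_real0.
  by rewrite !big_cons dualDE to_realD dualZE to_realM IH.
have phigE : to_real (phi g) = \sum_(h <- H) v h * to_real (phi h).
  rewrite /g linear_sum; elim: (H) => [|h s IH]; first by rewrite !big_nil to_real0.
  by rewrite !big_cons to_realD linearZ to_realM IH.
have gz z : rnorm z <= 1 -> to_real (g z) <= to_real (phi g) - d / 2.
  move=> z1; pose w := x + of_real k t *: (z - x).
  have w1 : rnorm w <= 1.
    rewrite (_ : w = of_real k (1 - t) *: x + of_real k t *: z); last first.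
      rewrite /w of_realD of_real1 of_realN scalerBl scale1r scalerBr addrA addrAC.
      by [].
    rewrite (le_trans (ler_rnormD _ _))// !rnormZ !rnorm_of_real.
    rewrite ger0_norm ?subr_ge0// ger0_norm ?(ltW t0)//.
    have := rnorm_ge0 x; have := rnorm_ge0 z; nra.
  have := dD w w1.
  pose S := \sum_(h <- H) v h * (to_real (h z) - to_real (h x)).
  pose Q := \sum_(h <- H) (to_real (h z) - to_real (h x)) ^+ 2.
  have -> : D w = D x - 2 * t * S + t ^+ 2 * Q.
    rewrite /D /S /Q !mulr_sumr -sumrB -big_split /=; apply: eq_bigr => h _.
    rewrite /w linearD linearZ/= linearB to_realD to_realM to_realD to_realN /v.
    ring.
  have QC : Q <= C.
    apply: ler_sum => h _; rewrite -ler_sqrt ?sqr_ge0// !sqrtr_sqr.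
    rewrite -to_realN -to_realD -linearB.
    rewrite [leRHS]ger0_norm ?mulr_ge0 ?rnorm_ge0//.
    have hB : rnorm (h (z - x)) <= 2 * rnorm h.
      rewrite (le_trans (rnorm_app _ _))// mulrC ler_wpM2r ?rnorm_ge0//.
      by rewrite (le_trans (ler_rnormB _ _))// (_ : 2 = 1 + 1)// lerD.
    rewrite ler_norml (le_trans (to_real_le _) hB) andbT lerNl -to_realN.
    by rewrite (le_trans (to_real_le _))// (rnormN (V := K^o)).
  have SE : S = to_real (g z) - to_real (phi g) + D x.
    rewrite gE phigE /S /D -sumrB -big_split /=; apply: eq_bigr => h _.
    rewrite /v; ring.
  move=> dle.
  have Dxd := dD x x1.
  have : 2 * t * S <= t * (d / 2) + t * (d / 2).
    have := ler_wpM2l (ltW (mulr_gt0 t0 t0)) QC.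
    have := ler_wpM2l (ltW t0) tC.
    nra.
  rewrite -mulrDr -splitr (mulrC 2) -mulrA ler_pM2l// SE; lra.
have g_le z : rnorm z <= 1 -> rnorm (g z) <= rnorm g - d / 2.
  move=> z1; have [u u1 ug] := unimodular (g z).
  rewrite -(of_realK (k := k) (rnorm (g z))) -ug.
  rewrite -[u * _](linearZ_LR g u z) (le_trans (gz _ _))//.
    by rewrite rnormZ u1 mul1r.
  rewrite lerD2r (le_trans (to_real_le _))// (le_trans (rnorm_app phi g))//.
  by rewrite ler_piMl ?rnorm_ge0.
suff : rnorm g <= rnorm g - d / 2 by lra.
rewrite [leLHS]rnorm_dual; apply: ge_sup.
  by exists (rnorm (g 0)), 0 => //; rewrite /unit_ball/= normr0.
by move=> _ [z z1 <-]; apply: g_le; rewrite rnorm_le1.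
Qed.

(** The imaginary part of [h x] is recovered from the real part of
    [(iota *: h) x], so the list [H] is doubled. *)
Lemma goldstine X (phi : dual (dual X)) (H : seq (dual X)) (e : R) :
  rnorm phi <= 1 -> 0 < e ->
  exists x, rnorm x <= 1 /\ forall h, h \in H -> rnorm (h x - phi h) < e.
Proof.
move=> phi1 e0; have e2 : 0 < e / 2 by rewrite divr_gt0.
have [x [x1 xH]] := goldstine_real (H ++ [seq iota *: h | h <- H]) phi1 e2.
exists x; split=> // h hH.
have a := xH h; have b := xH (iota *: h).
rewrite mem_cat hH in a; rewrite mem_cat map_f// orbT in b.
move: (a isT) (b isT); rewrite dualZE linearZ => {}a {}b.
rewrite (rnormB (V := K^o)) (scalar_decomp (phi h - h x)) (le_lt_trans (@ler_rnormB _ _ K^o _ _))//.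
rewrite (splitr e) ltr_leD//; first by rewrite rnorm_of_real to_realD to_realN.
rewrite rnormM rnorm_of_real mulrBr to_realD to_realN.
rewrite (le_trans _ (ltW b))// ler_piMl//; exact: rnorm_iota.
Qed.

(** Gantmacher: the biadjoint of a weakly compact [T] takes its values in [Y].
    By Goldstine's theorem a [phi] of norm at most [1] is a weak-* limit of
    points of the ball; their images under [T] have a weak limit [y] along an
    ultrafilter, which represents the image of [phi]. *)
Lemma gantmacher X Y (T : operator X Y) : weakly_compact_op T ->
  forall phi : dual (dual X), exists y, forall g : dual Y,
    phi (adjoint T g) = g y.
Proof.
move=> wT phi0.
wlog phi1 : phi0 / rnorm phi0 <= 1.
  move=> wl; have [->|p0] := eqVneq phi0 0.
    by exists 0 => g; rewrite raddf0.
  have r0 := rnorm_gt0 p0.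
  have [|y yg] := wl (of_real k (rnorm phi0)^-1 *: phi0).
    by rewrite rnormZ rnorm_of_real ger0_norm ?invr_ge0 ?(ltW r0)// mulVf ?gt_eqF.
  exists (of_real k (rnorm phi0) *: y) => g.
  rewrite linearZ /= -yg dualZE scalerA -of_realM mulfV ?gt_eqF// of_real1.
  by rewrite scale1r.
move: phi0 phi1 => phi phi1.
pose B (He : seq (dual X) * R) := [set x : X | rnorm x <= 1 /\
  forall h, h \in He.1 -> rnorm (h x - phi h) < He.2].
pose F := filter_from [set He : seq (dual X) * R | 0 < He.2] B.
have FF : ProperFilter F.
  apply: filter_from_proper; last first.
    by move=> [H e] /= e0; have [x xP] := goldstine H phi1 e0; exists x.
  apply: filter_from_filter; first by exists ([::], 1) => /=.
  move=> [H e] [H' e'] /= e0 e0'; exists (H ++ H', Num.min e e').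
    by rewrite /= lt_min e0.
  move=> x [x1 xH] /=; split; split=> // h hH.
    by have := xH h; rewrite mem_cat hH lt_min => /(_ isT)/andP[].
  by have := xH h; rewrite mem_cat hH orbT lt_min => /(_ isT)/andP[].
have [G [GU FG]] := ultraFilterLemma FF.
have GF := @ultra_proper _ _ GU.
have cT : weakly_compact (closure (T @` unit_ball X : set (weak Y))).
  by move: wT; rewrite /weakly_compact_op precompactE.
have [|y _ yT] := @weakly_compact_ultra Y _ _ G T cT GU.
  apply: FG; exists ([::], 1) => //= x [x1 _].
  by apply: subset_closure; exists x => //; rewrite /unit_ball/= -rnorm_le1.
exists y => g.
apply: (cvg_weak_unique GF _ (yT g)).
apply/cvg_rnormP => e e0; apply: FG; exists ([:: adjoint T g], e) => //= x [_ xP].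
exact: (xP (adjoint T g) (mem_head _ _)).
Qed.

Lemma gantmacher_weakly_compact X Y (T : operator X Y) : weakly_compact_op T ->
  weakly_compact (adjoint T @` unit_ball (dual Y)).
Proof.
move=> wT; apply: weak_star_image => phi.
by have [y yP] := gantmacher wT phi; exists y.
Qed.

End weak_compactness.

(** * Weakly convergent sequences: Eberlein-Smulian, uniform boundedness *)

Section weak_sequences.
Context {R : realType} {k : scalar_kind}.
Local Notation K := (scalars R k).
Local Notation iota := (iota_unit R k).
Implicit Types X Y V W : normedModType K.

Lemma rnorm_eq0P V (v : V) : (forall e : R, 0 < e -> rnorm v <= e) -> v = 0.
Proof.
move=> ve; apply: rnorm0_eq0; apply/eqP; rewrite eq_le rnorm_ge0 andbT.
by apply/ler_addgt0Pr => e e0; rewrite add0r ve.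
Qed.

Lemma seq_cvgP V (u : nat -> V) (l : V) : u @ \oo --> l <->
  forall e : R, 0 < e -> exists N, forall n, (N <= n)%N -> rnorm (u n - l) < e.
Proof.
split=> [/cvg_rnormP ul e e0|ul].
  by have [N _ NP] := ul e e0; exists N => n Nn; exact: NP.
apply/cvg_rnormP => e e0; have [N NP] := ul e e0.
by exists N => // n /= Nn; exact: NP.
Qed.

Lemma seq_cauchyP V (u : nat -> V) : cauchy (u @ \oo) <->
  forall e : R, 0 < e ->
    exists N, forall m n, (N <= m)%N -> (N <= n)%N -> rnorm (u m - u n) < e.
Proof.
split=> [/cauchy_ballP uc e e0|uc].
  have e0' : 0 < of_real k e by rewrite -(of_real0 (k := k)) ltr_of_real.
  have := uc _ e0'; rewrite near_map2 => -[[P Q] /= [[N _ NP] [M _ MP]] PQ].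
  exists (maxn N M) => m n; rewrite !geq_max => /andP[Nm _] /andP[_ Mn].
  have := PQ (m, n) (conj (NP _ Nm) (MP _ Mn)).
  by rewrite /= -ball_normE/= norm_rnorm ltr_of_real.
apply/cauchy_ballP => e e0; rewrite near_map2.
have er : e = of_real k (to_real e) by rewrite to_realK// gtr0_real.
have re : 0 < to_real e by rewrite -(ltr_of_real (k := k)) -er of_real0.
have [N NP] := uc _ re.
exists ([set n | (N <= n)%N], [set n | (N <= n)%N]); first by split; exists N.
move=> [m n] /= [Nm Nn]; rewrite -ball_normE/= er norm_rnorm ltr_of_real.
exact: NP.
Qed.

Lemma not_eventually_lt (a : nat -> R) (c : R) :
  ~ (exists N, forall n, (N <= n)%N -> a n < c) ->
  exists psi : nat -> nat, forall n, (n <= psi n)%N /\ c <= a (psi n).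
Proof.
move=> /forallNP bad.
have bad' N : exists n, (N <= n)%N /\ c <= a n.
  have /existsNP[n /not_implyP[Nn /negP]] := bad N.
  by rewrite -leNgt => en; exists n.
by have [psi psiP] := choice bad'; exists psi.
Qed.

Lemma complete_seq_cvg (V : completeNormedModType K) (u : nat -> V) :
  (forall e : R, 0 < e ->
    exists N, forall m n, (N <= m)%N -> (N <= n)%N -> rnorm (u m - u n) < e) ->
  exists l : V, u @ \oo --> l.
Proof.
move=> uc; suff : cvg (u @ \oo : set_system V) by move=> /cvg_ex.
by apply: cauchy_cvg; exact: (seq_cauchyP u).2 uc.
Qed.

(** The distance [p] to the range of [L] is a seminorm, and a functional
    dominated by it vanishes on the range. *)
Lemma annihilating_functional (Z : lmodType K) V (L : {linear Z -> V}) (x : V)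
    (e : R) : 0 < e -> (forall z, e <= rnorm (x - L z)) ->
  exists f : dual V, (forall z, f (L z) = 0) /\ f x != 0.
Proof.
move=> e0 xe.
pose p x := inf [set rnorm (x - L z) | z in [set: Z]].
have p_le y z : p y <= rnorm (y - L z).
  by apply: ge_inf; [exists 0 => _ [w _ <-]; exact: rnorm_ge0|exists z].
have le_p y a : (forall z, a <= rnorm (y - L z)) -> a <= p y.
  move=> ay; apply: lb_le_inf => [|_ [z _ <-]]; last exact: ay.
  by exists (rnorm (y - L 0)), 0.
have p0 : p 0 <= 0.
  by rewrite (le_trans (p_le _ 0))// raddf0 subr0 rnorm0.
have pge0 y : 0 <= p y by apply: (le_p) => z; exact: rnorm_ge0.
have pZ a y : p (a *: y) <= rnorm (a : K^o) * p y.
  have [->|a0] := eqVneq a 0; first by rewrite scale0r (rnorm0 K^o) mul0r.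
  have ra0 := rnorm_gt0 (V := K^o) a0.
  rewrite -ler_pdivrMl//; apply: (le_p) => z; rewrite ler_pdivrMl//.
  by rewrite (le_trans (p_le _ (a *: z)))// linearZ -scalerBr rnormZ.
have [|||f [fp fx]] := @seminorm_functional R k V p 1 x.
- move=> y y'; rewrite -lerBlDr; apply: (le_p) => z.
  rewrite lerBlDr [leRHS]addrC -lerBlDr; apply: (le_p) => z'.
  rewrite lerBlDr (le_trans (p_le _ (z + z')))// linearD opprD addrACA addrC.
  by rewrite (le_trans (ler_rnormD _ _))// addrC.
- move=> a y; apply/eqP; rewrite eq_le pZ /=.
  have [->|a0] := eqVneq a 0; first by rewrite (rnorm0 K^o) mul0r.
  have ra0 := rnorm_gt0 (V := K^o) a0.
  have := pZ a^-1 (a *: y); rewrite scalerK// -ler_pdivrMl; last first.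
    by rewrite (rnorm_gt0 (V := K^o))// invr_eq0.
  rewrite (_ : (rnorm (a^-1 : K^o))^-1 = rnorm (a : K^o))//.
  apply: (mulIf (x := rnorm (a^-1 : K^o))); first by rewrite gt_eqF// (rnorm_gt0 (V := K^o))// invr_eq0.
  rewrite mulVf; last by rewrite gt_eqF// (rnorm_gt0 (V := K^o))// invr_eq0.
  by rewrite -rnormM divff// rnorm1.
- by move=> y; rewrite mul1r (le_trans (p_le _ 0))// raddf0 subr0.
exists f; split=> [z|].
  apply: rnorm0_eq0; apply/eqP; rewrite eq_le rnorm_ge0 andbT.
  by rewrite (le_trans (fp _))// (le_trans (p_le _ z))// subrr rnorm0.
apply: contraTneq (lt_le_trans e0 (le_p x e xe)) => fx0.
by rewrite -fx fx0 rnorm0 ltxx.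
Qed.

(** Polynomials serve as finitely supported sequences of coefficients. *)
Definition lincomb V (u : nat -> V) (c : {poly K}) : V :=
  \sum_(i < size c) c`_i *: u i.

Lemma lincombE V (u : nat -> V) (c : {poly K}) n : (size c <= n)%N ->
  lincomb u c = \sum_(i < n) c`_i *: u i.
Proof.
move=> cn; rewrite /lincomb -(big_mkord predT (fun i => c`_i *: u i)).
rewrite -(big_mkord predT (fun i => c`_i *: u i)) (big_cat_nat (leq0n _) cn)//=.
rewrite [X in _ + X]big_nat [X in _ + X]big1 ?addr0// => i /andP[ci _].
by rewrite nth_default// scale0r.
Qed.

Lemma lincomb_linear V (u : nat -> V) : linear (lincomb u).
Proof.
move=> a c d; pose n := maxn (maxn (size c) (size d)) (size (a *: c + d)).
have cn : (size c <= n)%N by rewrite !leq_max leqnn.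
have dn : (size d <= n)%N by rewrite !leq_max leqnn orbT.
have sn : (size (a *: c + d)%R <= n)%N by rewrite !leq_max leqnn !orbT.
rewrite (lincombE u cn) (lincombE u dn) (lincombE u sn).
rewrite scaler_sumr -big_split/=; apply: eq_bigr => i _.
by rewrite coefD coefZ scalerDl scalerA.
Qed.

HB.instance Definition _ V (u : nat -> V) :=
  GRing.isLinear.Build K {poly K} V *:%R (lincomb u) (lincomb_linear u).

Lemma lincombXn V (u : nat -> V) n : lincomb u 'X^n = u n.
Proof.
rewrite (@lincombE _ _ _ n.+1) ?size_polyXn// big_ord_recr/= big1 ?add0r.
  by rewrite coefXn eqxx scale1r.
by move=> i _; rewrite coefXn ltn_eqF// scale0r.
Qed.

Definition rational_scalar (r : rat * rat) : K :=
  of_real k (ratr r.1) - iota * of_real k (ratr r.2).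

Lemma rational_scalar_dense (c : K) (e : R) : 0 < e ->
  exists r, rnorm (c - rational_scalar r : K^o) < e.
Proof.
move=> e0; have e2 : 0 < e / 2 by rewrite divr_gt0.
have real_dense (a : R) : exists q : rat, `|a - ratr q| < e / 2.
  have [|q] := @rat_in_itvoo R (a - e / 2) (a + e / 2); first by lra.
  by rewrite in_itv/= => /andP[q1 q2]; exists q; rewrite ltr_norml; lra.
have [a ca] := real_dense (to_real c).
have [b cb] := real_dense (to_real (iota * c)).
exists (a, b); rewrite /rational_scalar/= {1}(scalar_decomp c).
rewrite (_ : _ - _ = of_real k (to_real c - ratr a)
   - iota * of_real k (to_real (iota * c) - ratr b)); last first.
  by rewrite !of_realD !of_realN; ring.
rewrite (le_lt_trans (@ler_rnormB _ _ K^o _ _))// (splitr e) ltr_leD//.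
  by rewrite rnorm_of_real.
rewrite rnormM rnorm_of_real (le_trans _ (ltW cb))//.
by rewrite ler_piMl// rnorm_iota.
Qed.

(** A countable family, indexed by a countable type, dense in the span of [u]. *)
Definition rational_comb V (u : nat -> V) (s : seq (rat * rat)) : V :=
  \sum_(i < size s) rational_scalar (nth (0, 0) s i) *: u i.

Lemma rational_comb_dense V (u : nat -> V) (c : {poly K}) (e : R) : 0 < e ->
  exists s, rnorm (lincomb u c - rational_comb u s) < e.
Proof.
move=> e0; pose M := \sum_(i < size c) rnorm (u i).
have M0 : 0 <= M by apply: sumr_ge0 => i _; exact: rnorm_ge0.
have d0 : 0 < e / (M + 1) by rewrite divr_gt0// ltr_wpDl.
have [r rP] := choice (fun i => rational_scalar_dense c`_i d0).
exists (mkseq r (size c)); rewrite /rational_comb size_mkseq /lincomb -sumrB.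
apply: (@le_lt_trans _ _ (\sum_(i < size c) e / (M + 1) * rnorm (u i))); last first.
  rewrite -mulr_sumr -/M mulrAC -mulrA gtr_pMr// ltr_pdivrMr ?ltr_wpDl//.
  by rewrite mul1r ltrDl.
elim/big_ind2 : _ => [|v a w b va wb|i _]; first by rewrite rnorm0.
  by rewrite (le_trans (ler_rnormD _ _))// lerD.
by rewrite nth_mkseq// -scalerBl rnormZ ler_wpM2r ?rnorm_ge0// ltW.
Qed.

(** The form in which compactness is used on sequences: a weak cluster point,
    tested on finitely many functionals at a time. *)
Lemma weakly_compact_cluster V (A : set V) (u : nat -> V) :
  weakly_compact A -> (forall n, A (u n)) ->
  exists2 y, A y & forall (H : seq (dual V)) (e : R) N, 0 < e ->
    exists2 n, (N <= n)%N & forall h, h \in H -> rnorm (h (u n) - h y) < e.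
Proof.
move=> cA uA; have [G [GU oG]] := ultraFilterLemma (eventually_filter).
have GF := @ultra_proper _ _ GU.
have [|y Ay fy] := @weakly_compact_ultra R k V A _ G u cA GU.
  exact: filterE.
exists y => // H e N e0.
have HP : \forall n \near G, forall h, h \in H -> rnorm (h (u n) - h y) < e.
  elim: H => [|h s IH]; first exact: filterE.
  have /cvg_rnormP/(_ e e0) hP := fy h.
  apply: filterS2 hP IH => n hn sn g; rewrite inE => /orP[/eqP->|]; first exact: hn.
  exact: sn.
have NG : \forall n \near G, (N <= n)%N by apply: oG; exists N.
by have [n [nN nP]] := filter_ex (filterI NG HP); exists n.
Qed.

(** Weak cluster points of [u] lie in its closed span, which is separable, so
    countably many functionals [g] separate them. A subsequence along which
    every [g i] converges to its value at a cluster point [y] has no other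
    cluster point, hence converges weakly to [y]. *)
Theorem eberlein_smulian V (A : set V) (u : nat -> V) :
  weakly_compact A -> (forall n, A (u n)) ->
  exists2 phi : nat -> nat, {homo phi : m n / (m < n)%N} &
    exists2 y, A y & weakly_cvg (u \o phi) y.
Proof.
move=> cA uA.
have [y Ay yP] := weakly_compact_cluster cA uA.
have [G GP] := choice (fun s => norming_functional (rational_comb u s)).
pose g m : dual V := oapp G 0 (unpickle m : option (seq (rat * rat))).
have gE s : g (pickle s) = G s by rewrite /g pickleK.
have step Nn : exists m, (Nn.1 <= m)%N /\ forall i, (i <= Nn.2)%N ->
    rnorm (g i (u m) - g i y) < Nn.2.+1%:R^-1.
  have [|m Nm mP] := yP [seq g i | i <- seq.iota 0 Nn.2.+1] (Nn.2.+1%:R^-1) Nn.1.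
    by rewrite invr_gt0 ltr0n.
  exists m; split=> // i iN; apply: mP; apply: map_f.
  by rewrite mem_iota.
have [f fP] := choice step.
pose phi := fix phi n := if n is m.+1 then f ((phi m).+1, n) else f (0, 0)%N.
have phiP n i : (i <= n)%N -> rnorm (g i (u (phi n)) - g i y) < n.+1%:R^-1.
  case: n => [|n] iin; first exact: (fP (0, 0)%N).2.
  exact: (fP ((phi n).+1, n.+1)).2.
have phi_incr : {homo phi : m n / (m < n)%N}.
  by apply: homo_ltn => [m n p|n]; [exact: ltn_trans|exact: (fP ((phi n).+1, n.+1)).1].
exists phi => //; exists y => //; apply/weakly_cvgP => h; apply: contrapT.
move=> /seq_cvgP/existsNP[e /not_implyP[e0 /not_eventually_lt[psi psiP]]].
have [|z Az zP] := @weakly_compact_cluster V A (u \o phi \o psi) cA.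
  by move=> n; exact: uA.
have gz i : g i z = g i y.
  apply/eqP; rewrite -subr_eq0; apply/eqP; apply: (rnorm_eq0P (V := K^o)) => d d0.
  have d2 : 0 < d / 2 by rewrite divr_gt0.
  have [n nN /(_ (g i))] := zP [:: g i] _ (maxn i (Num.truncn (d / 2)^-1)) d2.
  rewrite inE eqxx => /(_ isT) /=; move: nN; rewrite geq_max => /andP[iin dn] nz.
  rewrite (_ : _ - _ = (g i (u (phi (psi n))) - g i y)
     - (g i (u (phi (psi n))) - g i z)); last by rewrite opprB [RHS]addrC addrA subrK.
  rewrite (le_trans (@ler_rnormB _ _ K^o _ _))// (splitr d) lerD//; last exact: ltW.
  have npsi := (psiP n).1.
  rewrite (le_trans (ltW (phiP _ _ (leq_trans iin npsi))))//.
  rewrite -[leRHS]invrK lef_pV2 ?posrE ?invr_gt0//.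
  rewrite (le_trans (ltW (truncnS_gt _)))// ler_nat ltnS.
  exact: leq_trans dn npsi.
(* Both [z] and [y] are in the closed span: a functional vanishing on [u]
   vanishes at them. *)
have zspan (e' : R) : 0 < e' -> exists c, rnorm (z - y - lincomb u c) < e'.
  move=> e'0; apply: contrapT => /forallNP zc.
  have [|w [wu]] := @annihilating_functional {poly K} V (lincomb u) (z - y) _ e'0.
    by move=> c; rewrite leNgt; apply/negP; exact: zc.
  have wu' n : w (u n) = 0 by rewrite -(lincombXn u n); exact: wu.
  suff : w z = 0 /\ w y = 0 by move=> [wz wy]; rewrite linearB/= wz wy subrr eqxx.
  split; apply: (rnorm_eq0P (V := K^o)) => d d0.
    have [n _ /(_ w)] := zP [:: w] _ 0 d0; rewrite inE eqxx => /(_ isT) /=.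
    by rewrite wu' sub0r (rnormN (V := K^o)) => /ltW.
  have [n _ /(_ w)] := yP [:: w] _ 0 d0; rewrite inE eqxx => /(_ isT) /=.
  by rewrite wu' sub0r (rnormN (V := K^o)) => /ltW.
(* [G s] almost attains the norm of [z - y] if [rational_comb u s] is close to
   it, and vanishes there. *)
have zy : z = y.
  apply/eqP; rewrite -subr_eq0; apply/eqP; apply: rnorm_eq0P => d d0.
  have d4 : 0 < d / 4 by rewrite divr_gt0.
  have [c cz] := zspan _ d4; have [s sc] := rational_comb_dense u c d4.
  have [Gs Gn] := GP s.
  have zs : rnorm (rational_comb u s - (z - y)) <= d / 2.
    rewrite rnormB (_ : z - y - _ = (z - y - lincomb u c)
      + (lincomb u c - rational_comb u s)); last by rewrite addrA subrK.
    rewrite (le_trans (ler_rnormD _ _))//; lra.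
  rewrite (le_trans (rnorm_subr _ (rational_comb u s)))// rnormB (splitr d) lerD//.
  rewrite -Gn (_ : G s _ = G s (rational_comb u s - (z - y))); last first.
    by rewrite [RHS]linearB/= [G s (z - y)]linearB/= -gE gz subrr subr0.
  rewrite (le_trans (rnorm_app _ _))// (le_trans _ zs)//.
  by rewrite ler_piMl ?rnorm_ge0.
have e2 : 0 < e / 2 by rewrite divr_gt0.
have [n _ /(_ h)] := zP [:: h] _ 0 e2.
rewrite inE eqxx zy => /(_ isT) /=; have := (psiP n).2; lra.
Qed.

(** Gliding hump: at distance at most [3^-j] from [w j] there is a [w j.+1]
    where the functional [phi (nn j)] reaches two thirds of [3^-j] times its
    norm. The later steps add up to at most half of [3^-j], so at the limit one
    sixth is left, which is unbounded as the norm exceeds [3 ^+ j * j.+1]. *)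
Theorem uniform_boundedness (W : completeNormedModType K) (phi : nat -> dual W) :
  (forall w, exists M : R, forall n, rnorm (phi n w) <= M) ->
  exists M : R, forall n, rnorm (phi n) <= M.
Proof.
move=> pb; apply: contrapT => /forallNP unb.
have big (j : nat) : exists n, 3 ^+ j * j.+1%:R < rnorm (phi n).
  by have /existsNP[n /negP] := unb (3 ^+ j * j.+1%:R); rewrite -ltNge; exists n.
have [nn nnP] := choice big.
have step (jw : nat * W) : exists w', rnorm (w' - jw.2) <= 3^-1 ^+ jw.1 /\
    2 / 3 * 3^-1 ^+ jw.1 * rnorm (phi (nn jw.1)) <= rnorm (phi (nn jw.1) w').
  move: jw => [j w] /=; set f := phi (nn j).
  have f0 : 0 < rnorm f.
    by rewrite (lt_trans _ (nnP j))// mulr_gt0// exprn_gt0.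
  have f4 : 2 / 3 * rnorm f < rnorm f by lra.
  have [z [z1 fz]] : exists z, rnorm z <= 1 /\ 2 / 3 * rnorm f <= rnorm (f z).
    apply: contrapT => /forallNP nz; move: f4; apply/negP; rewrite -leNgt.
    rewrite [leLHS]rnorm_dual; apply: ge_sup.
      by exists (rnorm (f 0)), 0 => //; rewrite /unit_ball/= normr0.
    move=> _ [z z1 <-]; rewrite leNgt; apply/negP => fz.
    by apply: (nz z); split; [rewrite rnorm_le1|exact: ltW].
  set r : R := 3^-1 ^+ j; have r0 : 0 <= r by rewrite exprn_ge0// invr_ge0.
  have nr : rnorm (of_real k r *: z) <= r.
    by rewrite rnormZ rnorm_of_real ger0_norm// ler_piMr.
  have fr : 2 / 3 * r * rnorm f <= rnorm (f (of_real k r *: z)).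
    rewrite linearZ (rnormZ (X := K^o)) rnorm_of_real (ger0_norm r0).
    by rewrite mulrAC [leLHS]mulrC ler_wpM2l.
  (* One of [w + r z] and [w - r z] will do, since [f] takes at their difference
     twice the value at [r z]. *)
  have [fw|fw] := leP (2 / 3 * r * rnorm f) (rnorm (f (w + of_real k r *: z))).
    by exists (w + of_real k r *: z); rewrite addrAC subrr add0r.
  exists (w - of_real k r *: z); rewrite addrAC subrr add0r rnormN; split=> //.
  have : 2 * rnorm (f (of_real k r *: z)) <= rnorm (f (w + of_real k r *: z))
      + rnorm (f (w - of_real k r *: z)).
    rewrite -[in leLHS](ger0_norm (ler0n R 2)) -(rnorm_of_real (k := k)) -rnormM.
    rewrite (le_trans _ (@ler_rnormB _ _ K^o _ _))// -linearB/= -[of_real k 2 * _](linearZ_LR f).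
    rewrite (_ : of_real k 2 *: _ = w + of_real k r *: z - (w - of_real k r *: z))//.
    rewrite opprB addrC addrA subrK (_ : 2 = 1 + 1)// of_realD of_real1 scalerDl.
    by rewrite scale1r.
  lra.
have [F FP] := choice step.
pose w := fix w n := if n is m.+1 then F (m, w m) else 0.
have wS j : rnorm (w j.+1 - w j) <= 3^-1 ^+ j := (FP (j, w j)).1.
have wB j : 2 / 3 * 3^-1 ^+ j * rnorm (phi (nn j)) <= rnorm (phi (nn j) (w j.+1)).
  exact: (FP (j, w j)).2.
have r0 j : 0 < 3^-1 ^+ j :> R by rewrite exprn_gt0// invr_gt0.
have wD j d : rnorm (w (j + d)%N - w j) <= 3 / 2 * 3^-1 ^+ j - 3 / 2 * 3^-1 ^+ (j + d).
  elim: d => [|d IH]; first by rewrite addn0 !subrr rnorm0.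
  rewrite addnS (_ : w (j + d).+1 - w j = (w (j + d).+1 - w (j + d)%N)
     + (w (j + d)%N - w j)); last by rewrite addrA subrK.
  rewrite (le_trans (ler_rnormD _ _))// (le_trans (lerD (wS _) IH))//.
  by rewrite exprS; lra.
have wm j m : (j <= m)%N -> rnorm (w m - w j) <= 3 / 2 * 3^-1 ^+ j.
  move=> jm; rewrite -(subnKC jm) (le_trans (wD _ _))//.
  by rewrite gerBl mulr_ge0// ltW.
have [l wl] : exists l : W, w @ \oo --> l.
  apply: complete_seq_cvg => e e0.
  have e3 : 0 < e / 3 by rewrite divr_gt0.
  have [N _ NP] : \forall j \near \oo, `|0 - 3^-1 ^+ j| < e / 3 :> R.
    have /cvgrPdist_lt/(_ _ e3)// : (fun j => 3^-1 ^+ j : R) @ \oo --> 0.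
    apply: cvg_expr; rewrite ger0_norm ?invr_ge0// invf_lt1//; lra.
  have := NP N (leqnn N); rewrite /= sub0r normrN (ger0_norm (ltW (r0 _))) => Ne.
  exists N => m n Nm Nn; rewrite (_ : w m - w n = (w m - w N) - (w n - w N)).
    rewrite (le_lt_trans (ler_rnormB _ _))//.
    have := wm _ _ Nm; have := wm _ _ Nn; lra.
  by rewrite opprB addrA subrK.
have lw j : rnorm (l - w j.+1) <= 3^-1 ^+ j / 2.
  apply: (@lim_rnorm_le _ _ _ _ \oo _ (fun m => w m - w j.+1)).
    by apply: cvgB => //; exact: cvg_cst.
  exists j.+1 => // m /= jm; rewrite (le_trans (wm _ _ jm))// exprS; lra.
have [M MP] := pb l.
have phil j : j.+1%:R / 6 <= M.
  rewrite (le_trans _ (MP (nn j)))//.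
  have h1 : rnorm (phi (nn j) (w j.+1 - l)) <= rnorm (phi (nn j)) * (3^-1 ^+ j / 2).
    by rewrite (le_trans (rnorm_app _ _))// ler_wpM2l ?rnorm_ge0// rnormB lw.
  have h2 := rnorm_subr (V := K^o) (phi (nn j) (w j.+1)) (phi (nn j) l).
  rewrite -linearB /= in h2.
  have h3 := wB j.
  have := ler_wpM2l (ltW (r0 j)) (ltW (nnP j)).
  rewrite mulrA -exprMn mulVf// expr1n mul1r.
  lra.
have := phil (Num.truncn (6 * M)); rewrite ler_pdivrMr// mulrC leNgt.
by rewrite truncnS_gt.
Qed.

End weak_sequences.

(** * Weakly null sequences and operators on absolutely summable sequences *)

Section l1_polynomials.
Context {R : realType} {k : scalar_kind}.
Local Notation K := (scalars R k).

(** Finitely supported sequences with the summable norm. This space is not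
    complete, but only its duals occur as domains and codomains of operators
    that have to be between Banach spaces; the first dual is the space of
    bounded sequences. *)
Definition l1poly : Type := {poly K}.
HB.instance Definition _ := GRing.Lmodule.on l1poly.

Definition l1_norm (c : {poly K}) : R := \sum_(i < size c) rnorm (c`_i : K^o).

Lemma l1_normE (c : {poly K}) n : (size c <= n)%N ->
  l1_norm c = \sum_(i < n) rnorm (c`_i : K^o).
Proof.
move=> cn; rewrite /l1_norm -(big_mkord predT (fun i => rnorm (c`_i : K^o))).
rewrite -(big_mkord predT (fun i => rnorm (c`_i : K^o))) (big_cat_nat (leq0n _) cn)//=.
rewrite [X in _ + X]big_nat [X in _ + X]big1 ?addr0// => i /andP[ci _].
by rewrite nth_default// (rnorm0 K^o).
Qed.

Lemma l1_norm_partial (c : {poly K}) n :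
  \sum_(i < n) rnorm (c`_i : K^o) <= l1_norm c.
Proof.
rewrite (@l1_normE c (n + size c)) ?leq_addl// big_split_ord/= lerDl.
by apply: sumr_ge0 => i _; exact: rnorm_ge0.
Qed.

Lemma l1_normD (c d : l1poly) :
  of_real k (l1_norm (c + d)) <= of_real k (l1_norm c) + of_real k (l1_norm d).
Proof.
rewrite -of_realD ler_of_real; pose n := maxn (maxn (size c) (size d)) (size (c + d)%R).
rewrite (@l1_normE c n) ?(@l1_normE d n) ?(@l1_normE (c + d) n);
  rewrite ?leq_max ?leqnn ?orbT//.
rewrite -big_split/=; apply: ler_sum => i _.
by rewrite coefD; exact: (@ler_rnormD _ _ K^o).
Qed.

Lemma l1_normZ (a : K) (c : l1poly) :
  of_real k (l1_norm (a *: c)) = `|a| * of_real k (l1_norm c).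
Proof.
rewrite (_ : `|a| = of_real k (rnorm (a : K^o))); last exact: (@norm_rnorm _ _ K^o).
rewrite -of_realM; congr of_real; rewrite (l1_normE (size_scale_leq a c)).
rewrite /l1_norm mulr_sumr; apply: eq_bigr => i _.
by rewrite coefZ rnormM.
Qed.

Lemma l1_norm0_eq0 (c : l1poly) : of_real k (l1_norm c) = 0 -> c = 0.
Proof.
rewrite -(of_real0 (k := k)) => /of_real_inj c0; apply/polyP => i; rewrite coef0.
apply: (@rnorm0_eq0 _ _ K^o); apply/eqP; rewrite eq_le rnorm_ge0 andbT -c0.
rewrite (le_trans _ (l1_norm_partial c i.+1))// big_ord_recr/= lerDr.
by apply: sumr_ge0 => j _; exact: rnorm_ge0.
Qed.

HB.instance Definition _ :=
  Lmodule_isNormed.Build K l1poly l1_normD l1_normZ l1_norm0_eq0.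

Lemma rnorm_l1 (c : l1poly) : rnorm c = l1_norm c.
Proof. exact: of_realK. Qed.

Lemma rnorm_l1Xn n : rnorm ('X^n : l1poly) = 1.
Proof.
rewrite rnorm_l1 (@l1_normE _ n.+1) ?size_polyXn// big_ord_recr/= big1 ?add0r.
  by rewrite coefXn eqxx rnorm1.
by move=> i _; rewrite coefXn ltn_eqF// (rnorm0 K^o).
Qed.

Lemma rnorm_lincomb (V : normedModType K) (v : nat -> V) (M : R) (c : l1poly) :
  (forall n, rnorm (v n) <= M) -> rnorm (lincomb v c) <= M * rnorm c.
Proof.
move=> vM; rewrite rnorm_l1 mulrC /l1_norm mulr_suml /lincomb.
elim/big_ind2 : _ => [|x a y b xa yb|i _]; first by rewrite rnorm0.
  by rewrite (le_trans (ler_rnormD _ _))// lerD.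
by rewrite rnormZ ler_wpM2l ?rnorm_ge0.
Qed.

Lemma lincomb_operator (V : normedModType K) (v : nat -> V) (M : R) :
  (forall n, rnorm (v n) <= M) ->
  exists T : operator l1poly V, forall c, T c = lincomb v c.
Proof.
move=> vM; apply: (operator_exists (C := M)) => [|c]; last exact: rnorm_lincomb.
exact: lincomb_linear.
Qed.

Lemma coef_functional n : exists e : dual l1poly, forall c : l1poly, e c = c`_n.
Proof.
apply: (dual_exists (C := 1)) => [a c d|c]; first by rewrite coefD coefZ.
rewrite mul1r rnorm_l1 (le_trans _ (l1_norm_partial c n.+1))// big_ord_recr/= lerDr.
by apply: sumr_ge0 => j _; exact: rnorm_ge0.
Qed.

(** [adjoint S phi] is the sequence of the [phi (v n)]. It tends to [0], so it
    is the norm limit of its truncations, on which [g] is computed from the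
    [g (e n)], [e n] being the coordinate functionals. These numbers are
    absolutely summable, and [x] is the sum of the series of the
    [g (e n) *: v n]. *)
Theorem weakly_null_representation (V : completeNormedModType K) (v : nat -> V)
    (M : R) (S : operator l1poly V) :
  weakly_cvg v 0 -> (forall n, rnorm (v n) <= M) ->
  (forall c, S c = lincomb v c) ->
  forall g : dual (dual l1poly), exists x, forall phi : dual V,
    g (adjoint S phi) = phi x.
Proof.
move=> v0 vM SE g.
have [e eE] := choice coef_functional.
pose a n := rnorm (g (e n)).
(* Test [g] on a combination of [N] coordinates with unimodular coefficients. *)
have a_sum N : \sum_(n < N) a n <= rnorm g.
  have unim n : exists u : K, rnorm (u : K^o) = 1 /\
      u * g (e n) = of_real k (a n).
    by have [u u1 ug] := unimodular (g (e n)); exists u.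
  have [u uP] := choice unim.
  pose s : dual l1poly := \sum_(n < N) u n *: e n.
  have sE c : s c = \sum_(n < N) u n * c`_n.
    rewrite /s; elim: (N) => [|j IH]; first by rewrite !big_ord0.
    by rewrite !big_ord_recr dualDE IH dualZE eE.
  have s1 : rnorm s <= 1.
    rewrite rnorm_dual; apply: dual_norm_le => // c; rewrite mul1r rnorm_l1 sE.
    rewrite (le_trans _ (l1_norm_partial c N))//.
    elim/big_ind2 : _ => [|x b y d xb yd|i _]; first by rewrite (rnorm0 K^o).
      by rewrite (le_trans (@ler_rnormD _ _ K^o _ _))// lerD.
    by rewrite rnormM (uP i).1 mul1r.
  have gs : g s = of_real k (\sum_(n < N) a n).
    rewrite /s linear_sum; elim: (N) => [|j IH].
      by rewrite !big_ord0 of_real0.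
    by rewrite !big_ord_recr/= IH of_realD linearZ; congr (_ + _); exact: (uP j).2.
  have a0 : 0 <= \sum_(n < N) a n by apply: sumr_ge0 => n _; exact: rnorm_ge0.
  rewrite -(ger0_norm a0) -(rnorm_of_real (k := k)) -gs.
  by rewrite (le_trans (rnorm_app _ _))// ler_piMr ?rnorm_ge0.
pose s N := \sum_(n < N) g (e n) *: v n.
have M0 : 0 <= M by rewrite (le_trans _ (vM 0%N))// rnorm_ge0.
have sB m n : (n <= m)%N ->
    rnorm (s m - s n) <= (\sum_(i < m) a i - \sum_(i < n) a i) * M.
  move=> /subnKC <-; elim: (m - n)%N => [|d IH].
    by rewrite addn0 !subrr rnorm0 mul0r.
  rewrite addnS /s !big_ord_recr/= addrAC -/(s _) -/(s _).
  rewrite (le_trans (ler_rnormD _ _))// addrAC mulrDl lerD//.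
  by rewrite rnormZ ler_wpM2l ?rnorm_ge0.
have [x sx] : exists x : V, s @ \oo --> x.
  apply: complete_seq_cvg => d d0.
  have ca : cvg ((fun N => \sum_(n < N) a n) @ \oo).
    apply: nondecreasing_is_cvgn.
      apply/nondecreasing_seqP => n; rewrite big_ord_recr/= lerDl; exact: rnorm_ge0.
    by exists (rnorm g) => _ [n _ <-].
  have dM : 0 < d / (2 * (M + 1)) by rewrite divr_gt0// mulr_gt0// ltr_wpDl.
  move/cvgrPdist_lt/(_ _ dM) : ca => -[N _ NP].
  exists N.
  have main m n : (N <= n)%N -> (n <= m)%N -> rnorm (s m - s n) < d.
    move=> Nn nm; rewrite (le_lt_trans (sB _ _ nm))//.
    have := NP _ Nn; have := NP _ (leq_trans Nn nm).
    rewrite /= !ltr_norml => /andP[a1 a2] /andP[b1 b2].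
    have D0 : 0 < M + 1 by rewrite ltr_wpDl.
    have dE : d / (2 * (M + 1)) * 2 * (M + 1) = d by field; rewrite gt_eqF.
    set D := d / _ in a1 a2 b1 b2 dM dE.
    rewrite -dE; apply: (@le_lt_trans _ _ (D * 2 * M)).
      by rewrite ler_wpM2r//; lra.
    by rewrite ltr_pM2l ?ltrDl// mulr_gt0.
  move=> m n Nm Nn; have [nm|/ltnW mn] := leqP n m; first exact: main.
  by rewrite rnormB; exact: main.
exists x => phi.
have phis : (phi \o s) @ \oo --> phi x.
  apply: (@cvg_comp _ _ _ s phi _ _ _ sx); exact: (@dual_continuous _ _ _ phi x).
apply: (cvg_weak_unique _ _ phis).
apply/seq_cvgP => d d0.
have d1 : 0 < d / (rnorm g + 1) by rewrite divr_gt0// ltr_wpDl ?rnorm_ge0.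
have /weakly_cvgP/(_ phi)/seq_cvgP/(_ _ d1)[N NP] := v0.
exists N => n Nn.
pose t : dual l1poly := \sum_(i < n) phi (v i) *: e i.
have tE c : t c = \sum_(i < n) phi (v i) * c`_i.
  rewrite /t; elim: (n) => [|j IH]; first by rewrite !big_ord0.
  by rewrite !big_ord_recr dualDE IH dualZE eE.
have -> : (phi \o s) n = g t.
  rewrite /= /s /t !linear_sum; apply: eq_bigr => i _.
  by rewrite !linearZ; exact: mulrC.
rewrite -linearB/= (le_lt_trans (rnorm_app _ _))//.
apply: (@le_lt_trans _ _ (rnorm g * (d / (rnorm g + 1)))); last first.
  by rewrite mulrA ltr_pdivrMr ?ltr_wpDl ?rnorm_ge0//; nra.
rewrite ler_wpM2l ?rnorm_ge0// rnormB [leLHS]rnorm_dual.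
apply: dual_norm_le => [|c]; first exact: ltW.
rewrite dualBE /= SE (@lincombE _ _ _ v c (n + size c)) ?leq_addl//.
rewrite linear_sum big_split_ord/= tE.
rewrite (_ : _ - _ = \sum_(i < size c) c`_(n + i) * phi (v (n + i)%N)); last first.
  rewrite addrAC (_ : \sum_(i < n) _ = \sum_(i < n) phi (v i) * c`_i).
    by rewrite subrr add0r; apply: eq_bigr => i _; rewrite linearZ.
  by apply: eq_bigr => i _; rewrite linearZ; exact: mulrC.
rewrite rnorm_l1 (@l1_normE c (n + size c)) ?leq_addl// big_split_ord/=.
apply: (@le_trans _ _ (\sum_(i < size c) rnorm (c`_(n + i) : K^o) * (d / (rnorm g + 1)))).
  elim/big_ind2 : _ => [|y b z b' yb zb'|i _]; first by rewrite (rnorm0 K^o).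
    by rewrite (le_trans (@ler_rnormD _ _ K^o _ _))// lerD.
  rewrite rnormM ler_wpM2l ?rnorm_ge0//.
  have := NP (n + i)%N (leq_trans Nn (leq_addr _ _)).
  by rewrite raddf0 subr0 => /ltW.
rewrite -mulr_suml mulrC ler_wpM2l ?(ltW d1)// lerDr.
by apply: sumr_ge0 => i _; exact: rnorm_ge0.
Qed.

End l1_polynomials.

(** * The quantities, and weakly null sequences *)

Section quantities_theory.
Context {R : realType} {k : scalar_kind}.
Local Notation K := (scalars R k).
Implicit Types X Y V W Z : normedModType K.

Lemma ler_rnorm_dist V (x y z : V) : rnorm (x - z) <= rnorm (x - y) + rnorm (y - z).
Proof. by rewrite -[x - z](subrKA y) ler_rnormD. Qed.

(** Inequalities with [omega] are proved by comparison with every real number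
    above it, since the infimum defining [omega] need not be attained. *)
Lemma le_mule_approx (x w : \bar R) (a : R) : 0 < a ->
  (forall c : R, (w < c%:E)%E -> (x <= (a * c)%:E)%E) -> (x <= a%:E * w)%E.
Proof.
move=> a0; case: w => [r|_|xc].
- move=> xc; apply/lee_addgt0Pr => e e0.
  have ea : 0 < e / a by rewrite divr_gt0.
  rewrite -EFinM -EFinD (_ : _ + _ = a * (r + e / a)); last first.
    by field; rewrite gt_eqF.
  by apply: xc; rewrite lte_fin ltrDl.
- by rewrite gt0_muley ?lte_fin// leey.
- rewrite gt0_muleNy ?lte_fin//; move: x xc => [r| |]// xc; last first.
    by have := xc 0 (ltNyr _); rewrite mulr0.
  have := xc ((r - 1) / a) (ltNyr _).
  by rewrite mulrC divfK ?gt_eqF// lee_fin lerDl oppr_ge0 ler10.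
Qed.

Lemma lt_fin_approx (x : \bar R) (c : R) : (x < c%:E)%E ->
  exists2 c', c' < c & (x < c'%:E)%E.
Proof.
case: x => [r| |]//; last by exists (c - 1); rewrite ?ltNyr// gtrDl ltrN10.
by rewrite lte_fin => rc; exists ((r + c) / 2); rewrite ?lte_fin; lra.
Qed.

Lemma omega_ltP V (A : set V) (c : R) : (omega A < c%:E)%E ->
  exists2 B, weakly_compact B &
    forall a, A a -> exists2 b, B b & rnorm (a - b) < c.
Proof.
move=> /ereal_inf_ltP[_ [B [_ wB] <-] dc]; exists B => // a Aa.
have /ereal_inf_ltP[_ [b Bb <-]] :
    (ereal_inf [set (rnorm (a - b))%:E | b in B] < c%:E)%E.
  by apply: le_lt_trans dc; apply: ereal_sup_ubound; exists a.
by rewrite lte_fin => ab; exists b.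
Qed.

Lemma omega_le0 V (A B : set V) : B !=set0 -> weakly_compact B -> A `<=` B ->
  (omega A <= 0)%E.
Proof.
move=> B0 wB AB; apply: (@le_trans _ _ (dhat A B)).
  by apply: ereal_inf_lbound; exists B.
apply: ge_ereal_sup => _ [a Aa <-]; apply: ereal_inf_lbound.
by exists a; [exact: AB|rewrite subrr rnorm0].
Qed.

Lemma tail_sup_le (d : nat -> nat -> \bar R) (c : \bar R) N :
  (forall i j, (N <= i)%N -> (N <= j)%N -> (d i j <= c)%E) -> (tail_sup d <= c)%E.
Proof.
move=> dc; apply: ge_ereal_inf; eexists; first by exists N.
by apply: ge_ereal_sup => _ [i Ni [j Nj <-]]; exact: dc.
Qed.

Lemma tail_sup_ltP (d : nat -> nat -> \bar R) (c : \bar R) : (tail_sup d < c)%E ->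
  exists N, forall i j, (N <= i)%N -> (N <= j)%N -> (d i j < c)%E.
Proof.
move=> /ereal_inf_ltP[_ [N _ <-] dc]; exists N => i j Ni Nj.
by apply: le_lt_trans dc; apply: ereal_sup_ubound; exists i => //; exists j.
Qed.

Lemma limn_esup_le (u : nat -> \bar R) (c : \bar R) N :
  (forall n, (N <= n)%N -> (u n <= c)%E) -> (limn_esup u <= c)%E.
Proof.
move=> uc; apply: ge_ereal_inf; eexists.
  by exists [set n | (N <= n)%N] => //; exists N.
by apply: ge_ereal_sup => _ [n Nn <-]; exact: uc.
Qed.

Lemma limn_esup_ltP (u : nat -> \bar R) (c : \bar R) : (limn_esup u < c)%E ->
  exists N, forall n, (N <= n)%N -> (u n < c)%E.
Proof.
move=> /ereal_inf_ltP[_ [A [N _ NA] <-] uc]; exists N => n Nn.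
apply: le_lt_trans uc; apply: ereal_sup_ubound; exists n => //; exact: NA.
Qed.

Lemma bounded_fun_rnormP V (T : Type) (v : T -> V) :
  bounded_fun v <-> exists M : R, forall t, rnorm (v t) <= M.
Proof.
split.
  move=> /pinfty_ex_gt0[r r0 vr]; exists (to_real r) => t.
  by rewrite -(ler_of_real (k := k)) to_realK ?gtr0_real// -norm_rnorm; exact: vr.
move=> [M vM]; rewrite /bounded_near /=; near=> r => t _ /=.
rewrite norm_rnorm (le_trans (y := of_real k M))// ?ler_of_real//.
near: r; apply: nbhs_pinfty_ge; exact: of_real_real.
Unshelve. all: by end_near. Qed.

Lemma weakly_cvgB V (u w : nat -> V) (x y : V) :
  weakly_cvg u x -> weakly_cvg w y -> weakly_cvg (fun n => u n - w n) (x - y).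
Proof.
move=> /weakly_cvgP ux /weakly_cvgP wy; apply/weakly_cvgP => f.
rewrite linearB (_ : f \o _ = (f \o u) - (f \o w)); last first.
  by apply/funext => n; rewrite /= linearB.
by apply: cvgB.
Qed.

Lemma weakly_cvgZ V (a : K) (u : nat -> V) (x : V) :
  weakly_cvg u x -> weakly_cvg (fun n => a *: u n) (a *: x).
Proof.
move=> /weakly_cvgP ux; apply/weakly_cvgP => f.
rewrite linearZ (_ : f \o _ = (fun n => a *: f (u n))); last first.
  by apply/funext => n; rewrite /= linearZ.
exact: cvgZl_tmp (ux f).
Qed.

Lemma weakly_cvg_cst V (x : V) : weakly_cvg (fun _ => x) x.
Proof. by apply/weakly_cvgP => f; exact: cvg_cst. Qed.

Lemma weakly_cvg_null V (u : nat -> V) (x : V) :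
  weakly_cvg u x -> weakly_cvg (fun n => u n - x) 0.
Proof. by move=> ux; rewrite -(subrr x); exact/weakly_cvgB/weakly_cvg_cst. Qed.

Lemma weakly_nullP V (u : nat -> V) : weakly_cvg u 0 <->
  forall (f : dual V) (e : R), 0 < e ->
    exists N, forall n, (N <= n)%N -> rnorm (f (u n)) < e.
Proof.
split=> [/weakly_cvgP u0 f e e0|u0].
  have [N NP] := (seq_cvgP (V := K^o) _ _).1 (u0 f) e e0; exists N => n Nn.
  by have := NP n Nn; rewrite raddf0 subr0.
apply/weakly_cvgP => f; apply/(seq_cvgP (V := K^o)) => e e0.
have [N NP] := u0 f e e0; exists N => n Nn.
by rewrite raddf0 subr0; exact: NP.
Qed.

Lemma weakly_null_sub V (u : nat -> V) (psi : nat -> nat) :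
  (forall n, (n <= psi n)%N) -> weakly_cvg u 0 -> weakly_cvg (u \o psi) 0.
Proof.
move=> npsi /weakly_nullP u0; apply/weakly_nullP => f e e0.
have [N NP] := u0 f e e0; exists N => n Nn; apply: NP.
exact: leq_trans Nn (npsi n).
Qed.

Lemma weakly_cauchyP V (u : nat -> V) : weakly_cauchy u <->
  forall (f : dual V) (e : R), 0 < e -> exists N, forall m n,
    (N <= m)%N -> (N <= n)%N -> rnorm (f (u m - u n)) < e.
Proof.
split=> uc f.
  move=> e e0; have [N NP] := (seq_cauchyP (V := K^o) _).1 (uc f) e e0.
  by exists N => m n Nm Nn; rewrite linearB; exact: NP.
apply/(seq_cauchyP (V := K^o)) => e e0; have [N NP] := uc f e e0.
by exists N => m n Nm Nn; rewrite /= -linearB; exact: NP.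
Qed.

Lemma weakly_cvg_cauchy V (u : nat -> V) (x : V) :
  weakly_cvg u x -> weakly_cauchy u.
Proof.
move=> /weakly_cvgP ux f; apply: cvg_cauchy; apply/cvg_ex; exists (f x).
exact: ux.
Qed.

Lemma weakly_cauchy_diff V (u : nat -> V) (i j : nat -> nat) :
  weakly_cauchy u -> (forall n, (n <= i n)%N) -> (forall n, (n <= j n)%N) ->
  weakly_cvg (fun n => u (i n) - u (j n)) 0.
Proof.
move=> /weakly_cauchyP uc ni nj; apply/weakly_nullP => f e e0.
have [N NP] := uc f e e0; exists N => n Nn.
by apply: NP; [exact: leq_trans (ni n)|exact: leq_trans (nj n)].
Qed.

Lemma incr_ge_id (phi : nat -> nat) : {homo phi : m n / (m < n)%N} ->
  forall n, (n <= phi n)%N.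
Proof.
move=> ph; elim=> [//|n IH]; exact: leq_ltn_trans IH (ph _ _ (ltnSn n)).
Qed.

Lemma weak_hausdorff V : hausdorff_space (weak V).
Proof.
move=> x y; rewrite cluster_cvgE => -[G GF [Gy xG]].
have Gx : G --> (x : weak V) by [].
apply/eqP; rewrite -subr_eq0; apply/eqP.
have [f [_ fx]] := norming_functional ((x : V) - (y : V)).
have fxy : f (x : V) = f (y : V).
  by apply: (cvg_weak_unique GF); apply: (@weak_cvgP _ _ V G _ _).1.
apply: rnorm0_eq0; rewrite -fx linearB.
have -> : f (x : V) - f (y : V) = 0 by rewrite fxy subrr.
exact: rnorm0 K^o.
Qed.

Lemma sub_weakly_precompact V (A B : set V) : weakly_compact B -> A `<=` B ->
  precompact (A : set (weak V)).
Proof.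
move=> wB AB; apply: (@precompact_subset (weak V) A B AB).
by apply: compact_precompact; [exact: weak_hausdorff|exact: wB].
Qed.

(** An ultrafilter containing the set either contains a singleton, or contains
    the complement of every finite part of the sequence and then converges to
    [0]. *)
Lemma weakly_null_compact V (v : nat -> V) : weakly_cvg v 0 ->
  weakly_compact (range v `|` [set 0]).
Proof.
move=> /weakly_nullP v0; apply: weakly_compact_ultraP => F FU FA.
have FF := @ultra_proper _ _ FU.
have [[a [Aa Fa]]|nA] := pselect (exists a, (range v `|` [set 0]) a /\ F [set a]).
  exists a => // f; apply/cvg_rnormP => e e0.
  by apply: filterS Fa => _ /= ->; rewrite subrr (rnorm0 K^o).
exists 0; first by right.
have Fn n : F (~` [set v n]).
  have [Fv|//] := in_ultra_setVsetC [set v n] FU.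
  by exfalso; apply: nA; exists (v n); split=> //; left; exists n.
have FN N : F [set y | forall n, (n < N)%N -> y <> v n].
  elim: N => [|N IH]; first exact: filterE.
  apply: filterS2 (Fn N) IH => y yN IH n.
  by rewrite ltnS leq_eqVlt => /orP[/eqP->//|]; exact: IH.
move=> f; apply/cvg_rnormP => e e0; have [N NP] := v0 f e e0.
apply: filterS2 FA (FN N) => y [[n _ <-]|->] yN; rewrite raddf0 subr0.
  by apply: NP; rewrite leqNgt; apply/negP => /yN.
by rewrite (rnorm0 K^o).
Qed.

Lemma omega_weakly_null V (v : nat -> V) : weakly_cvg v 0 ->
  (omega (range v) <= 0)%E.
Proof.
move=> v0; apply: omega_le0 (weakly_null_compact v0) _; last by left.
by exists 0; right.
Qed.

Lemma operator_bounded X Y (T : operator X Y) :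
  exists2 C : R, 0 <= C & forall x, rnorm (T x) <= C * rnorm x.
Proof.
have /linear_continuousP[C TC] := @op_continuous _ _ _ T.
exists `|C| => // x; rewrite (le_trans (TC x))// ler_wpM2r ?rnorm_ge0//.
exact: ler_norm.
Qed.

(** Uniform boundedness applies to the evaluations at the [u n], which live on
    the complete space [dual X]. *)
Lemma weakly_cvg_bounded X (u : nat -> X) (x : X) : weakly_cvg u x ->
  exists2 L : R, 0 < L & forall n, rnorm (u n) <= L.
Proof.
move=> /weakly_cvgP ux.
have [|M MP] := @uniform_boundedness R k (dual X) (fun n => bidual (u n)).
  move=> f; have : cvg ((f \o u) @ \oo) by apply/cvg_ex; exists (f x); exact: ux.
  by move=> /cvg_seq_bounded/bounded_fun_rnormP[M fM]; exists M => n; exact: fM.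
exists (`|M| + 1) => [|n]; first by rewrite ltr_wpDl.
rewrite -rnorm_bidual (le_trans (MP n))// (le_trans (ler_norm M))//.
by rewrite lerDl.
Qed.

End quantities_theory.

(** * Pairings of two normed spaces *)

(** A bounded bilinear form, given by its two partial maps so that both partial
    functionals are available as elements of the duals. *)
Record pairing (R : realType) (k : scalar_kind) (U V : normedModType (scalars R k)) :=
  Pairing {
  pairing_l : U -> dual V;
  pairing_r : V -> dual U;
  pairing_lr : forall u v, pairing_l u v = pairing_r v u;
  pairing_le : forall u v, rnorm (pairing_r v u) <= rnorm u * rnorm v }.

Section pairings.
Context {R : realType} {k : scalar_kind}.
Local Notation K := (scalars R k).
Implicit Types X Y U V W Z : normedModType K.

Lemma pairing_swap_le U V (B : pairing U V) v u :
  rnorm (pairing_l B u v) <= rnorm v * rnorm u.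
Proof. by rewrite pairing_lr mulrC; exact: pairing_le. Qed.

Definition pairing_swap U V (B : pairing U V) : pairing V U :=
  Pairing (fun v u => esym (pairing_lr B u v)) (pairing_swap_le B).

Lemma dual_pairing_le X (x : X) (f : dual X) : rnorm (f x) <= rnorm x * rnorm f.
Proof. by rewrite mulrC rnorm_app. Qed.

Definition dual_pairing X : pairing X (dual X) :=
  @Pairing R k X (dual X) (@bidual R k X) id (fun _ _ => erefl) (@dual_pairing_le X).

(** For [dual_pairing X] this is the classical description of the Dunford-Pettis
    property by sequences. *)
Definition dunford_pettis_pairing U V (B : pairing U V) :=
  forall (u : nat -> U) (v : nat -> V) (M : R),
    weakly_cvg u 0 -> weakly_cvg v 0 ->
    (forall n, rnorm (u n) <= M) -> (forall n, rnorm (v n) <= M) ->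
    forall e : R, 0 < e ->
      exists N, forall n, (N <= n)%N -> rnorm (pairing_r B (v n) (u n)) < e.

Lemma dunford_pettis_swap U V (B : pairing U V) :
  dunford_pettis_pairing B -> dunford_pettis_pairing (pairing_swap B).
Proof.
move=> dB v u M v0 u0 vM uM e e0; have [N NP] := dB u v M u0 v0 uM vM e e0.
by exists N => n Nn; rewrite /= pairing_lr; exact: NP.
Qed.

Lemma pairingBr U V (B : pairing U V) u v w :
  pairing_r B (v - w) u = pairing_r B v u - pairing_r B w u.
Proof. by rewrite -!pairing_lr linearB. Qed.

(** If infinitely many [n] were exceptional, approximate [v] along them by
    elements [w] of a weakly compact set and, by the Eberlein-Smulian theorem,
    pass to a subsequence where [w] converges weakly to some [y]. There [u] is
    null against [w - y] by the property of the pairing and against [y] by weak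
    convergence, while [v - w] contributes at most [L * c'] with [c' < c]. *)
Theorem pairing_omega U V (B : pairing U V) (A : set V) (u : nat -> U)
    (v : nat -> V) (L M c : R) :
  dunford_pettis_pairing B -> weakly_cvg u 0 -> 0 < L ->
  (forall n, rnorm (u n) <= L) -> (forall n, A (v n)) ->
  (forall n, rnorm (v n) <= M) -> (omega A < c%:E)%E ->
  exists N, forall n, (N <= n)%N -> rnorm (pairing_r B (v n) (u n)) < L * c.
Proof.
move=> dB u0 L0 uL Av vM /lt_fin_approx[c' cc' /omega_ltP[C wC AC]].
apply: contrapT => /not_eventually_lt[psi psiP].
have near_C n : exists b, C b /\ rnorm (v (psi n) - b) < c'.
  by have [b Cb vb] := AC _ (Av (psi n)); exists b.
have [w wP] := choice near_C.
have [phi phi_incr [y Cy wy]] := eberlein_smulian wC (fun n => (wP n).1).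
have npsi n : (n <= psi (phi n))%N.
  by rewrite (leq_trans (incr_ge_id phi_incr n))//; case: (psiP (phi n)).
have up0 : weakly_cvg (u \o (psi \o phi)) 0 by exact: weakly_null_sub.
(* A common bound for [u] and for [w - y]. *)
pose M' := M + c' + rnorm y + L.
have w_bd n : rnorm (w n) <= M + c'.
  rewrite (le_trans (rnorm_subr _ (v (psi n))))// addrC lerD// rnormB ltW//.
  by case: (wP n).
have c'0 : 0 < c' by case: (wP 0%N) => _; apply: le_lt_trans; exact: rnorm_ge0.
have M0 : 0 <= M by rewrite (le_trans _ (vM 0%N))// rnorm_ge0.
have e0 : 0 < L * (c - c') / 2 by rewrite divr_gt0// mulr_gt0// subr_gt0.
have [||N1 N1P] := dB _ _ M' up0 (weakly_cvg_null wy) _ _ _ e0.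
- by move=> n; rewrite (le_trans (uL _))// /M' lerDr !addr_ge0 ?rnorm_ge0// ltW.
- move=> n; rewrite (le_trans (ler_rnormB _ _))// /M' -addrA lerD//; first exact: w_bd.
  by rewrite lerDl ltW.
have [N2 N2P] := (weakly_nullP _).1 up0 (pairing_r B y) _ e0.
pose n := maxn N1 N2.
have := N1P n (leq_maxl _ _); have := N2P n (leq_maxr _ _).
set m := phi n; rewrite /= pairingBr -/m.
have [_ bm] := psiP m; have [_ wm] := wP m.
have := pairing_le B (u (psi m)) (v (psi m) - w m); rewrite pairingBr.
set b1 := pairing_r B (v _) _ in bm *; set b2 := pairing_r B (w _) _.
set b3 := pairing_r B y _.
have t1 := rnorm_subr (V := K^o) b1 b2; have t2 := rnorm_subr (V := K^o) b2 b3.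
have := ler_pM (rnorm_ge0 _) (rnorm_ge0 _) (uL (psi m)) (ltW wm).
move: bm t1 t2.
move: (rnorm b1) (rnorm b2) (rnorm b3) (rnorm (b1 - b2)) (rnorm (b2 - b3)) => r1 r2 r3 r12 r23.
move: (_ * rnorm _) => p; clear; lra.
Qed.

(** Approximate [v] by [w] in a weakly compact set and let [phi] be a
    subsequence along which [w] converges weakly. Differences of late terms of
    [w] are weakly null, so by [pairing_omega] with the two spaces exchanged
    they are uniformly small on [F], where [omega] vanishes; the two
    approximation errors add up to [2 * c]. *)
Theorem pairing_subsequence U V (B : pairing U V) (v : nat -> V) (M c : R) :
  dunford_pettis_pairing B -> (forall n, rnorm (v n) <= M) ->
  (omega (range v) < c%:E)%E ->
  exists2 phi : nat -> nat, {homo phi : m n / (m < n)%N} &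
    forall F : set U, weakly_compact F -> F `<=` unit_ball U ->
      exists N, forall i j u, (N <= i)%N -> (N <= j)%N -> F u ->
        rnorm (pairing_r B (v (phi i) - v (phi j)) u) <= 2 * c.
Proof.
move=> dB vM /lt_fin_approx[c' cc' /omega_ltP[C wC AC]].
have near_C n : exists b, C b /\ rnorm (v n - b) < c'.
  by have [|b Cb vb] := AC (v n); [exists n|exists b].
have [w wP] := choice near_C.
have [phi phi_incr [y Cy wy]] := eberlein_smulian wC (fun n => (wP n).1).
exists phi => // F wF F1; apply: contrapT => /forallNP bad.
have bad' N : exists t : nat * nat * U, [/\ (N <= t.1.1)%N, (N <= t.1.2)%N, F t.2 &
    2 * c < rnorm (pairing_r B (v (phi t.1.1) - v (phi t.1.2)) t.2)].
  have /existsNP[i /existsNP[j /existsNP[u]]] := bad N.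
  move=> /not_implyP[Ni /not_implyP[Nj /not_implyP[Fu /negP]]].
  by rewrite -ltNge => lt; exists (i, j, u).
have [t tP] := choice bad'.
pose z n := w (phi (t n).1.1) - w (phi (t n).1.2).
have z0 : weakly_cvg z 0.
  apply: (weakly_cauchy_diff (weakly_cvg_cauchy wy)) => n; by case: (tP n).
have w_bd n : rnorm (w n) <= M + c'.
  rewrite (le_trans (rnorm_subr _ (v n)))// addrC lerD// rnormB ltW//.
  by case: (wP n).
have c'0 : 0 < c' by case: (wP 0%N) => _; apply: le_lt_trans; exact: rnorm_ge0.
have M0 : 0 <= M by rewrite (le_trans _ (vM 0%N))// rnorm_ge0.
pose L := 2 * (M + c').
have L0 : 0 < L by rewrite mulr_gt0// ltr_wpDl.
have zL n : rnorm (z n) <= L.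
  rewrite (le_trans (ler_rnormB _ _))// /L mulrDl mul1r lerD//; exact: w_bd.
have Ft n : F (t n).2 by case: (tP n).
have Ft1 n : rnorm (t n).2 <= 1 by rewrite rnorm_le1; exact/F1.
have [|N NP] := pairing_omega (c := 2 * (c - c') / L) (dunford_pettis_swap dB)
  z0 L0 zL Ft Ft1.
  apply: le_lt_trans (omega_le0 _ wF (@subset_refl _ F)) _.
    by exists (t 0%N).2.
  by rewrite lte_fin divr_gt0// mulr_gt0// subr_gt0.
have := NP N (leqnn N); rewrite mulrCA divff ?gt_eqF// mulr1 /= pairing_lr.
have [_ _ _ lt] := tP N; set u := (t N).2 in lt *.
set i := (t N).1.1 in lt; set j := (t N).1.2 in lt.
rewrite /z -/i -/j => zlt.
have [_ wi] := wP (phi i); have [_ wj] := wP (phi j).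
have vw n : rnorm (v n - w n) < c' ->
    rnorm (pairing_r B (v n) u - pairing_r B (w n) u) <= c'.
  move=> vwn; rewrite -pairingBr (le_trans (pairing_le _ _ _))//.
  by rewrite -[leRHS]mul1r; apply: ler_pM; rewrite ?rnorm_ge0 ?Ft1 ?(ltW vwn).
move: lt zlt (vw _ wi) (vw _ wj); rewrite !pairingBr.
have := ler_rnorm_dist (V := K^o) (pairing_r B (v (phi i)) u)
  (pairing_r B (w (phi i)) u) (pairing_r B (v (phi j)) u).
have := ler_rnorm_dist (V := K^o) (pairing_r B (w (phi i)) u)
  (pairing_r B (w (phi j)) u) (pairing_r B (v (phi j)) u).
rewrite (rnormB (V := K^o) (pairing_r B (w (phi j)) u)).
lra.
Qed.

End pairings.

(** * The equivalent inequalities *)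

Section implications.
Context {R : realType} {k : scalar_kind}.
Local Notation K := (scalars R k).
Implicit Types Y Z U V W : normedModType K.

(** Differences of terms of [z] are weakly null but only of norm at most [2]:
    this is the factor in the inequalities on [cc]. *)
Lemma ca_le_omega U V (B : pairing U V) Z (s : nat -> Z) (z : nat -> U)
    (A : set V) (M c : R) :
  dunford_pettis_pairing B -> weakly_cauchy z -> (forall n, rnorm (z n) <= 1) ->
  (forall a, A a -> rnorm a <= M) ->
  (forall i j d, d < rnorm (s i - s j) ->
    exists2 a, A a & d < rnorm (pairing_r B a (z i - z j))) ->
  (omega A < c%:E)%E -> (ca s <= (2 * c)%:E)%E.
Proof.
move=> dB zc z1 AM As Ac; rewrite leNgt; apply/negP => lt.
have big N : exists t : nat * nat * V, [/\ (N <= t.1.1)%N, (N <= t.1.2)%N, A t.2 &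
    2 * c < rnorm (pairing_r B t.2 (z t.1.1 - z t.1.2))].
  apply: contrapT => nt; move: lt; apply/negP; rewrite -leNgt.
  apply: (tail_sup_le (N := N)) => i j Ni Nj; rewrite lee_fin leNgt; apply/negP.
  by move=> /As[a Aa lta]; apply: nt; exists (i, j, a).
have [t tP] := choice big.
have u0 : weakly_cvg (fun n => z (t n).1.1 - z (t n).1.2) 0.
  by apply: (weakly_cauchy_diff zc) => n; case: (tP n).
have tA n : A (t n).2 by case: (tP n).
have [|N NP] := pairing_omega dB u0 (ltr0n R 2) _ tA (fun n => AM _ (tA n)) Ac.
  move=> n; rewrite (le_trans (ler_rnormB _ _))// (_ : 2 = 1 + 1)// lerD//; exact: z1.
have := NP N (leqnn N); have [_ _ _] := tP N; lra.
Qed.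

Lemma weakly_compact_omega_op Y Z (T : operator Y Z) :
  weakly_compact (T @` unit_ball Y) -> (omega_op T <= 0)%E.
Proof.
move=> wT; apply: (omega_le0 _ wT) => //.
by exists (T 0), 0 => //; rewrite /unit_ball/= normr0.
Qed.

(** [cc] sees only sequences in the ball; dividing by [L + 1] rather than [L]
    avoids a case distinction for [L = 0]. *)
Lemma cc_le0_cauchy Y Z (T : operator Y Z) (u : nat -> Y) (L : R) :
  (cc T <= 0)%E -> weakly_cauchy u -> (forall n, rnorm (u n) <= L) ->
  forall e : R, 0 < e ->
    exists N, forall m n, (N <= m)%N -> (N <= n)%N -> rnorm (T (u m - u n)) < e.
Proof.
move=> cT uc uL e e0.
have L0 : 0 <= L by rewrite (le_trans _ (uL 0%N))// rnorm_ge0.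
have L1 : 0 < L + 1 by rewrite ltr_wpDl.
pose a : K := of_real k (L + 1)^-1.
have ra : rnorm (a : K^o) = (L + 1)^-1.
  by rewrite rnorm_of_real ger0_norm// invr_ge0 ltW.
have ac : weakly_cauchy (fun n => a *: u n).
  apply/weakly_cauchyP => f d d0.
  have [N NP] := (weakly_cauchyP _).1 uc f _ (mulr_gt0 L1 d0).
  exists N => m n Nm Nn; rewrite -scalerBr linearZ (rnormZ (X := K^o)) ra.
  by rewrite ltr_pdivrMl//; exact: NP.
have : (ca (T \o (fun n => a *: u n)) < (e / (L + 1))%:E)%E.
  apply: (@le_lt_trans _ _ 0%E); last by rewrite lte_fin divr_gt0.
  apply: le_trans cT; apply: ereal_sup_ubound; exists (fun n => a *: u n) => //.
  split=> // n; rewrite /unit_ball/= -rnorm_le1 rnormZ ra ler_pdivrMl// mulr1.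
  by rewrite (le_trans (uL n))// lerDl.
move=> /tail_sup_ltP[N NP]; exists N => m n Nm Nn.
have := NP m n Nm Nn; rewrite lte_fin /= -linearB -scalerBr linearZ rnormZ ra.
by rewrite mulrC ltr_pM2r ?invr_gt0.
Qed.

(** If [T (u n)] stayed away from [0], norming functionals [g n] would pair
    [adjoint T (g n)], which lies in a weakly compact set by Gantmacher's
    theorem, with the weakly null [u n] without tending to [0]. *)
Lemma dunford_pettis_of_sequences (X : completeNormedModType K) :
  dunford_pettis_pairing (dual_pairing X) -> dunford_pettis X.
Proof.
move=> dX Y T wT x_ [x xx]; exists (T x).
have u0 := weakly_cvg_null xx; pose u n := x_ n - x.
have [L L0 uL] := weakly_cvg_bounded u0.
apply: contrapT => /seq_cvgP/existsNP[e /not_implyP[e0 /not_eventually_lt[psi psiP]]].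
have [g gP] := choice (fun n => norming_functional (T (u (psi n)))).
have g1 n : unit_ball (dual Y) (g n) by rewrite /unit_ball/= -rnorm_le1 (gP n).1.
have [C C0 TC] := operator_bounded (adjoint T).
have wA := gantmacher_weakly_compact wT.
have Av n : (adjoint T @` unit_ball (dual Y)) (adjoint T (g n)) by exists (g n).
have [|||N NP] := pairing_omega (M := C) (c := e / L) dX
  (weakly_null_sub (fun n => (psiP n).1) u0) L0 _ Av.
- by move=> n; exact: uL.
- by move=> n; rewrite (le_trans (TC _))// ler_piMr//; exact: (gP n).1.
- apply: le_lt_trans (weakly_compact_omega_op wA) _.
  by rewrite lte_fin divr_gt0.
have := NP N (leqnn N); rewrite mulrCA divff ?gt_eqF// mulr1.
rewrite (_ : pairing_r _ _ _ = g N (T (u (psi N))))// (gP N).2.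
by apply/negP; rewrite -leNgt /u linearB; exact: (psiP N).2.
Qed.

Lemma weakly_compact_representation (V : completeNormedModType K) (v : nat -> V)
    (M : R) (S : operator l1poly V) :
  weakly_cvg v 0 -> (forall n, rnorm (v n) <= M) ->
  (forall c, S c = lincomb v c) ->
  weakly_compact (adjoint S @` unit_ball (dual V)).
Proof. by move=> v0 vM SE; apply: weak_star_image; exact: weakly_null_representation SE. Qed.

(** The operator [T] sends [x] to the sequence of the [f_ n x]: it is the
    restriction to [X] of the adjoint of the operator [S] with coefficients
    [f_], hence weakly compact. The limit of [T (x_ n)] can only be [0], and the
    norm of [T (x_ n)] dominates [f_ n (x_ n)]. *)
Lemma dunford_pettis_sequences (X : completeNormedModType K) :
  dunford_pettis X -> dunford_pettis_pairing (dual_pairing X).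
Proof.
move=> dX x_ f_ M x0 f0 xM fM e e0.
have [S SE] := lincomb_operator fM.
have [||T TE] := @operator_exists R k X (dual l1poly)
    (fun x => adjoint S (bidual x)) M.
- by move=> a x y; rewrite bidual_linear linearP.
- move=> x; rewrite [leLHS]rnorm_dual; apply: dual_norm_le => [|c].
    by rewrite mulr_ge0 ?rnorm_ge0// (le_trans _ (fM 0%N))// rnorm_ge0.
  rewrite /= (le_trans (rnorm_app _ _))// mulrAC ler_wpM2r ?rnorm_ge0//.
  rewrite (_ : S c = lincomb f_ c)//; exact: rnorm_lincomb.
have wT : weakly_compact_op T.
  apply: (sub_weakly_precompact (weakly_compact_representation f0 fM SE)).
  move=> _ [x x1 <-]; exists (bidual x); last by rewrite TE.
  by move: x1; rewrite /unit_ball/= -!rnorm_le1 rnorm_bidual.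
have [|y Ty] := dX _ T wT x_; first by exists 0.
have TEE n (c : l1poly) : T (x_ n) c = lincomb f_ c (x_ n) by rewrite TE /= SE.
have y0 : y = 0.
  apply/dualP => c; apply: (@rnorm_eq0P R k K^o) => d d0.
  have d2 : 0 < d / 2 by rewrite divr_gt0.
  have c1 : 0 < rnorm c + 1 by rewrite ltr_wpDl ?rnorm_ge0.
  have [N NP] := (seq_cvgP _ _).1 Ty _ (divr_gt0 d2 c1).
  have [N' NP'] := (weakly_nullP _).1 x0 (lincomb f_ c) _ d2.
  pose n := maxn N N'.
  have := NP' n (leq_maxr _ _); rewrite -TEE => t1.
  have := NP n (leq_maxl _ _); rewrite ltr_pdivlMr//= => t2.
  have t3 := rnorm_app (T (x_ n) - y) c.
  have t4 := rnorm_subr (V := K^o) (y c) (T (x_ n) c).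
  rewrite dualBE (rnormB (V := K^o)) in t3.
  have := rnorm_ge0 (T (x_ n) - y); have := rnorm_ge0 c.
  move: t1 t2 t3 t4; move: (rnorm (y c)) (rnorm (T (x_ n) c)) => a1 a2.
  move: (rnorm (_ - _)) (rnorm (_ - _)) (rnorm c) => a3 a4 a5.
  clear; nra.
have [N NP] := (seq_cvgP _ _).1 Ty _ e0; exists N => n Nn.
have := NP n Nn; rewrite y0 subr0; apply: le_lt_trans.
rewrite (_ : pairing_r _ _ _ = T (x_ n) ('X^n : l1poly)); last by rewrite TEE lincombXn.
by rewrite (le_trans (rnorm_app _ _))// rnorm_l1Xn mulr1.
Qed.

(** The operator [T] maps [g] to the vector representing it for the sequence
    [x_]; it sends the evaluation at the monomial of degree [n] to [x_ n], so
    that the norm of [adjoint T f] dominates all the [f (x_ n)]. As [T] maps the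
    ball onto a weakly compact set, [adjoint T] maps [f_] to a norm Cauchy
    sequence, and [f_ m (x_ n)] tends to [0] as [m] tends to infinity. *)
Lemma sequences_of_adjoint_cc (X : completeNormedModType K) :
  (forall (Y : completeNormedModType K) (T : operator Y X),
    (cc (adjoint T) <= 2%:E * omega_op T)%E) ->
  dunford_pettis_pairing (dual_pairing X).
Proof.
move=> ccT x_ f_ M x0 f0 xM fM e e0.
have [S SE] := lincomb_operator xM.
have [h hP] := choice (weakly_null_representation x0 xM SE).
have inj (x y : X) : (forall phi : dual X, phi x = phi y) -> x = y.
  move=> xy; apply/eqP; rewrite -subr_eq0; apply/eqP; apply: rnorm0_eq0.
  by have [f [_ <-]] := norming_functional (x - y); rewrite linearB /= xy subrr (rnorm0 K^o).
have M0 : 0 <= M by rewrite (le_trans _ (xM 0%N))// rnorm_ge0.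
have [||T TE] := @operator_exists R k (dual (dual l1poly)) X h M.
- by move=> a g g'; apply: inj => phi; rewrite linearP /= -!hP.
- move=> g; have [phi [phi1 <-]] := norming_functional (h g).
  rewrite -hP (le_trans (rnorm_app _ _))// mulrC ler_wpM2r ?rnorm_ge0//.
  rewrite [leLHS]rnorm_dual; apply: dual_norm_le => // c.
  rewrite /= (le_trans (rnorm_app _ _))// SE.
  rewrite (le_trans (ler_piMl _ phi1)) ?rnorm_ge0//; exact: rnorm_lincomb.
have cT : (cc (adjoint T) <= 0)%E.
  apply: le_trans (ccT _ T) _; apply: mule_ge0_le0; first by rewrite lee_fin.
  apply: weakly_compact_omega_op; apply: weak_star_image => phi.
  by exists (adjoint S phi) => g; rewrite TE hP.
have e2 : 0 < e / 2 by rewrite divr_gt0.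
have [N NP] := cc_le0_cauchy cT (weakly_cvg_cauchy f0) fM e2.
exists N => n Nn.
have Tn : T (bidual ('X^n : l1poly)) = x_ n.
  by apply: inj => phi; rewrite TE -hP /= SE lincombXn.
have /weakly_nullP/(_ (bidual (x_ n)) _ e2)[N' NP'] := f0.
pose m := maxn N N'.
have := NP n m Nn (leq_maxl _ _).
have := rnorm_app (adjoint T (f_ n - f_ m)) (bidual ('X^n : l1poly)).
rewrite rnorm_bidual rnorm_l1Xn mulr1.
rewrite (_ : adjoint T _ _ = f_ n (x_ n) - f_ m (x_ n)); last by rewrite /= Tn.
have := NP' m (leq_maxr _ _); rewrite (_ : bidual _ _ = f_ m (x_ n))//.
have := rnorm_subr (V := K^o) (f_ n (x_ n)) (f_ m (x_ n)).
rewrite (_ : pairing_r _ _ _ = f_ n (x_ n))//.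
move: (rnorm (f_ n (x_ n))) (rnorm (f_ m (x_ n))) (rnorm (_ - _)) (rnorm (adjoint T _)).
clear; move=> *; lra.
Qed.

Lemma sequences_of_limn_esup U V (B : pairing U V) :
  (forall (u : nat -> U) (v : nat -> V), weakly_cvg u 0 -> weakly_cvg v 0 ->
    (forall n, unit_ball U (u n)) -> bounded_fun v ->
    (limn_esup (fun n => (rnorm (pairing_r B (v n) (u n)))%:E) <= 0)%E) ->
  dunford_pettis_pairing B.
Proof.
move=> H u v M u0 v0 uM vM e e0.
have M0 : 0 <= M by rewrite (le_trans _ (uM 0%N))// rnorm_ge0.
have M1 : 0 < M + 1 by rewrite ltr_wpDl.
pose a : K := of_real k (M + 1)^-1.
have ra : rnorm (a : K^o) = (M + 1)^-1.
  by rewrite rnorm_of_real ger0_norm// invr_ge0 ltW.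
have au0 : weakly_cvg (fun n => a *: u n) 0 by rewrite -(scaler0 _ a); exact: weakly_cvgZ.
have : (limn_esup (fun n => (rnorm (pairing_r B (v n) (a *: u n)))%:E) < (e / (M + 1))%:E)%E.
  apply: (@le_lt_trans _ _ 0%E); last by rewrite lte_fin divr_gt0.
  apply: (H (fun n => a *: u n)) => //.
    move=> n; rewrite /unit_ball/= -rnorm_le1 rnormZ ra ler_pdivrMl// mulr1.
    by rewrite (le_trans (uM n))// lerDl.
  by apply/bounded_fun_rnormP; exists M.
move=> /limn_esup_ltP[N NP]; exists N => n Nn.
have := NP n Nn; rewrite lte_fin linearZ (rnormZ (X := K^o)) ra.
by rewrite mulrC ltr_pM2r ?invr_gt0.
Qed.

(** Along the subsequence all late [v i - v j] are small at a given [u i]; let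
    [j] tend to infinity. The weakly compact [F] to use is the range of the
    sequence [u], scaled into the ball, with [0]. *)
Lemma sequences_of_tails U V (B : pairing U V) :
  (forall v : nat -> V, weakly_cvg v 0 -> bounded_fun v -> forall d : R, 0 < d ->
    exists2 phi : nat -> nat, {homo phi : m n / (m < n)%N} &
      forall F : set U, weakly_compact F -> F `<=` unit_ball U ->
        exists N, forall i j u, (N <= i)%N -> (N <= j)%N -> F u ->
          rnorm (pairing_r B (v (phi i) - v (phi j)) u) < d) ->
  dunford_pettis_pairing B.
Proof.
move=> H u v M u0 v0 uM vM e e0; apply: contrapT => /not_eventually_lt[psi psiP].
have M0 : 0 <= M by rewrite (le_trans _ (uM 0%N))// rnorm_ge0.
have M1 : 0 < M + 1 by rewrite ltr_wpDl.
pose a : K := of_real k (M + 1)^-1.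
have ra : rnorm (a : K^o) = (M + 1)^-1.
  by rewrite rnorm_of_real ger0_norm// invr_ge0 ltW.
have npsi n : (n <= psi n)%N by case: (psiP n).
have au0 : weakly_cvg (fun n => a *: u n) 0 by rewrite -(scaler0 _ a); exact: weakly_cvgZ.
have d0 : 0 < e / (M + 1) / 2 by rewrite !divr_gt0.
have [|phi phi_incr phiP] := H _ (weakly_null_sub npsi v0) _ _ d0.
  by apply/bounded_fun_rnormP; exists M => n; exact: vM.
have [|N NP] := phiP _ (weakly_null_compact au0).
  move=> _ [[n _ <-]|->]; last by rewrite /unit_ball/= normr0.
  rewrite /unit_ball/= -rnorm_le1 rnormZ ra ler_pdivrMl// mulr1.
  by rewrite (le_trans (uM n))// lerDl.
pose n := psi (phi N).
have /weakly_nullP/(_ (pairing_l B (a *: u n)) _ d0)[N' NP'] := v0.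
pose j := maxn N N'.
have jN' : (N' <= psi (phi j))%N.
  rewrite (leq_trans (leq_maxr N N'))// (leq_trans (incr_ge_id phi_incr _))//.
have := NP N j (a *: u n) (leqnn _) (leq_maxl _ _).
move=> /(_ (or_introl (imageP _ I))); rewrite pairingBr /= -/n.
have := NP' _ jN'; rewrite pairing_lr.
have := rnorm_subr (V := K^o) (pairing_r B (v n) (a *: u n))
  (pairing_r B (v (psi (phi j))) (a *: u n)).
have : e / (M + 1) <= rnorm (pairing_r B (v n) (a *: u n)).
  rewrite linearZ (rnormZ (X := K^o)) ra mulrC ler_pM2l ?invr_gt0//.
  by case: (psiP (phi N)).
move: (rnorm _) (rnorm _) (rnorm _) (e / _); clear; move=> *; lra.
Qed.

Lemma image_ball_bounded Y Z (T : operator Y Z) :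
  exists M : R, forall a, (T @` unit_ball Y) a -> rnorm a <= M.
Proof.
have [C C0 TC] := operator_bounded T; exists C => _ [y + <-].
by rewrite /unit_ball/= -rnorm_le1 => y1; rewrite (le_trans (TC y))// ler_piMr.
Qed.

Lemma sequences_limn_esup U V (B : pairing U V) (u : nat -> U) (v : nat -> V) :
  dunford_pettis_pairing B -> weakly_cvg u 0 -> (forall n, unit_ball U (u n)) ->
  bounded_fun v ->
  (limn_esup (fun n => (rnorm (pairing_r B (v n) (u n)))%:E) <= omega (range v))%E.
Proof.
move=> dB u0 u1 /bounded_fun_rnormP[M vM]; rewrite -[leRHS]mul1e.
apply: le_mule_approx => // c wc; rewrite mul1r.
have [||N NP] := pairing_omega dB u0 (@ltr01 R) _ _ vM wc.
- by move=> n; rewrite rnorm_le1; exact: u1.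
- by move=> n; exists n.
by apply: (limn_esup_le (N := N)) => n Nn; rewrite lee_fin -[c]mul1r ltW// NP.
Qed.

Lemma sequences_cc (X : completeNormedModType K) Y (T : operator X Y) :
  dunford_pettis_pairing (dual_pairing X) ->
  (cc T <= 2%:E * omega_op (adjoint T))%E.
Proof.
move=> dX; have [M AM] := image_ball_bounded (adjoint T).
apply: le_mule_approx => // c wc; apply: ge_ereal_sup => _ [z [zc z1] <-].
apply: (ca_le_omega dX zc _ AM _ wc) => [n|i j d].
  by rewrite rnorm_le1; exact: z1.
have [g [g1 gT]] := norming_functional (T (z i - z j)).
rewrite /= -linearB -gT => lt; exists (adjoint T g) => //.
by exists g => //; rewrite /unit_ball/= -rnorm_le1.
Qed.

Lemma sequences_adjoint_cc (X : completeNormedModType K) Y (T : operator Y X) :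
  dunford_pettis_pairing (dual_pairing X) ->
  (cc (adjoint T) <= 2%:E * omega_op T)%E.
Proof.
move=> dX; have [M AM] := image_ball_bounded T.
apply: le_mule_approx => // c wc; apply: ge_ereal_sup => _ [z [zc z1] <-].
apply: (ca_le_omega (dunford_pettis_swap dX) zc _ AM _ wc) => [n|i j d].
  by rewrite rnorm_le1; exact: z1.
rewrite /= -linearB /= => lt; apply: contrapT => nA; move: lt; apply/negP.
rewrite -leNgt [leLHS]rnorm_dual; apply: ge_sup.
  by exists (rnorm (adjoint T (z i - z j) 0)), 0 => //; rewrite /unit_ball/= normr0.
move=> _ [y y1 <-]; rewrite leNgt; apply/negP => lt; apply: nA.
by exists (T y) => //; exists y.
Qed.

(** [ca_rho_star] for [dual_pairing X], and [ca_rho] for the same pairing with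
    the spaces exchanged. *)
Definition ca_pairing U V (B : pairing U V) (v : nat -> V) : \bar R :=
  ereal_sup [set tail_sup (fun i j =>
      ereal_sup [set (rnorm (pairing_r B (v i - v j) u))%:E | u in F]) | F in
    [set F | weakly_compact F /\ F `<=` unit_ball U]].

Definition ca_pairing_tilde U V (B : pairing U V) (v : nat -> V) : \bar R :=
  ereal_inf [set ca_pairing B w | w in subsequences v].

Lemma sequences_ca_pairing U V (B : pairing U V) (v : nat -> V) :
  dunford_pettis_pairing B -> bounded_fun v ->
  (ca_pairing_tilde B v <= 2%:E * omega (range v))%E.
Proof.
move=> dB /bounded_fun_rnormP[M vM]; apply: le_mule_approx => // c wc.
have [phi phi_incr phiP] := pairing_subsequence dB vM wc.
apply: (@le_trans _ _ (ca_pairing B (v \o phi))).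
  by apply: ereal_inf_lbound; exists (v \o phi) => //; exists phi.
apply: ge_ereal_sup => _ [F [wF F1] <-].
have [N NP] := phiP F wF F1; apply: (tail_sup_le (N := N)) => i j Ni Nj.
by apply: ge_ereal_sup => _ [u Fu <-]; rewrite lee_fin; exact: NP.
Qed.

Lemma sequences_of_ca_pairing U V (B : pairing U V) :
  (forall v : nat -> V, bounded_fun v ->
    (ca_pairing_tilde B v <= 2%:E * omega (range v))%E) ->
  dunford_pettis_pairing B.
Proof.
move=> H; apply: sequences_of_tails => v v0 vb d d0.
have : (ca_pairing_tilde B v < d%:E)%E.
  apply: le_lt_trans (H v vb) _; apply: (@le_lt_trans _ _ 0%E).
    by apply: mule_ge0_le0; [rewrite lee_fin|exact: omega_weakly_null].
  by rewrite lte_fin.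
move=> /ereal_inf_ltP[_ [_ [phi phi_incr <-] <-] phid]; exists phi => // F wF F1.
have /tail_sup_ltP[N NP] : (tail_sup (fun i j => ereal_sup
    [set (rnorm (pairing_r B (v (phi i) - v (phi j)) u))%:E | u in F]) < d%:E)%E.
  by apply: le_lt_trans phid; apply: ereal_sup_ubound; exists F.
exists N => i j u Ni Nj Fu; rewrite -lte_fin; apply: le_lt_trans (NP i j Ni Nj).
by apply: ereal_sup_ubound; exists u.
Qed.

Lemma dunford_pettis_of_cc (X : completeNormedModType K) :
  (forall (Y : completeNormedModType K) (T : operator X Y),
    (cc T <= 2%:E * omega_op (adjoint T))%E) ->
  dunford_pettis X.
Proof.
move=> ccT Y T wT x_ [x xx].
have cT : (cc T <= 0)%E.
  apply: le_trans (ccT Y T) _; apply: mule_ge0_le0; first by rewrite lee_fin.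
  exact/weakly_compact_omega_op/gantmacher_weakly_compact.
have [L _ xL] := weakly_cvg_bounded xx.
apply: complete_seq_cvg => e e0.
have [N NP] := cc_le0_cauchy cT (weakly_cvg_cauchy xx) xL e0.
by exists N => m n Nm Nn; rewrite /= -linearB; exact: NP.
Qed.

End implications.

Local Open Scope ereal_scope.

Theorem theorem5p2 (R : realType) (k : scalar_kind)
    (X : completeNormedModType (scalars R k)) :
  [<-> dunford_pettis X;
       forall (Y : completeNormedModType (scalars R k)) (T : operator X Y),
         cc T <= 2%:E * omega_op (adjoint T);
       forall (Y : completeNormedModType (scalars R k)) (T : operator Y X),
         cc (adjoint T) <= 2%:E * omega_op T;
       forall (x_ : nat -> X) (f_ : nat -> dual X),
         weakly_cvg x_ 0%R -> (forall n, unit_ball X (x_ n)) ->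
         bounded_fun f_ ->
         limn_esup (fun n => (rnorm (f_ n (x_ n)))%:E) <= omega (range f_);
       forall (x_ : nat -> X) (f_ : nat -> dual X),
         bounded_fun x_ ->
         weakly_cvg f_ 0%R -> (forall n, unit_ball (dual X) (f_ n)) ->
         limn_esup (fun n => (rnorm (f_ n (x_ n)))%:E) <= omega (range x_);
       forall f_ : nat -> dual X, bounded_fun f_ ->
         ca_rho_star_tilde f_ <= 2%:E * omega (range f_);
       forall x_ : nat -> X, bounded_fun x_ ->
         ca_rho_tilde x_ <= 2%:E * omega (range x_)].
Proof.
have swap_dual : dunford_pettis_pairing (pairing_swap (dual_pairing X)) ->
    dunford_pettis_pairing (dual_pairing X).
  by move=> /dunford_pettis_swap.
tfae.
- by move=> /dunford_pettis_sequences dX Y T; exact: sequences_cc.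
- move=> /dunford_pettis_of_cc/dunford_pettis_sequences dX Y T.
  exact: sequences_adjoint_cc.
- move=> /sequences_of_adjoint_cc dX x_ f_ x0 x1 fb.
  exact: (sequences_limn_esup dX x0 x1 fb).
- move=> H x_ f_ xb f0 f1.
  have dX : dunford_pettis_pairing (dual_pairing X).
    apply: sequences_of_limn_esup => u v u0 v0 u1 vb.
    exact: le_trans (H u v u0 u1 vb) (omega_weakly_null v0).
  exact: (sequences_limn_esup (dunford_pettis_swap dX) f0 f1 xb).
- move=> H f_ fb; apply: (@sequences_ca_pairing _ _ _ _ (dual_pairing X)) fb.
  apply/swap_dual/sequences_of_limn_esup => f x f0 x0 f1 xb.
  exact: le_trans (H x f xb f0 f1) (omega_weakly_null x0).
- move=> H x_ xb.
  apply: (@sequences_ca_pairing _ _ _ _ (pairing_swap (dual_pairing X))) xb.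
  by apply/dunford_pettis_swap/sequences_of_ca_pairing => f fb; exact: H.
- move=> H; apply/dunford_pettis_of_sequences/swap_dual.
  by apply: sequences_of_ca_pairing => x xb; exact: H.
Qed.
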